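(* For all integers $b,c,d$ with $2\le b\le c\le d$ and $b\neq 3$, excluding the quadruples $(2,b,c,d)=(2,2,2,d)$ with $d>2$, there exists a connected graph $G$ with $g(G)=2$, $eg(G)=b$, $seg(G)=c$ and $meg(G)=d$.
   Context: All graphs are finite, simple, undirected and connected. Let $G$ be such a graph with vertex set $V(G)$ and edge set $E(G)$. - A geodetic set of $G$ is a set $S\subseteq V(G)$ such that every vertex of $G$ lies on some (at least one) shortest path between some pair of distinct vertices of $S$. The geodetic number $g(G)$ is the minimum cardinality of a geodetic set. - An edge-geodetic set of $G$ is a set $S\subseteq V(G)$ such that every edge of $G$ lies on some (at least one) shortest path between some pair of distinct vertices of $S$. The edge-geodetic number $eg(G)$ is the minimum cardinality of an edge-geodetic set. - A strong edge-geodetic set of $G$ is a set $S\subseteq V(G)$ for which one can choose, for each unordered pair of distinct vertices $u,v\in S$, one specific shortest $u$--$v$ path $P_{uv}$, such that every edge of $G$ lies on at least one of the chosen paths. The strong edge-geodetic number $seg(G)$ is the minimum cardinality of a strong edge-geodetic set. - A monitoring edge-geodetic set (MEG-set) of $G$ is a set $S\subseteq V(G)$ such that for every edge $e\in E(G)$ there is a pair of distinct vertices $u,v\in S$ such that $e$ lies on every shortest $u$--$v$ path in $G$. The monitoring edge-geodetic number $meg(G)$ is the minimum cardinality of an MEG-set. *)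

(* Defs.v *)
From mathcomp Require Import all_boot.

Set Implicit Arguments.
Unset Strict Implicit.
Unset Printing Implicit Defensive.

Record sgraph := SGraph {
  vertex :> finType;
  adj : rel vertex;
  adj_sym : symmetric adj;
  adj_irr : irreflexive adj }.

Section Geodetic.
Variable G : sgraph.
Implicit Types (u v x y : G) (w : seq G) (S : {set G}).

Definition connected_graph : Prop := forall x y, connect (@adj G) x y.

(* A walk is the full list of its vertices, both endpoints included. *)
Definition walk u v w : bool :=
  if w is x :: p then [&& x == u, path (@adj G) x p & last x p == v] else false.

(* A walk of minimum length never repeats a vertex, so this is the usual notion
   of shortest path. *)
Definition geodesic u v w : Prop :=
  walk u v w /\ forall w', walk u v w' -> size w <= size w'.

Definition edge_on x y w : bool :=
  ((x, y) \in zip w (behead w)) || ((y, x) \in zip w (behead w)).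

Definition geodetic_set S : Prop :=
  forall x, exists u v w,
    [/\ u \in S, v \in S, u != v, geodesic u v w & x \in w].

Definition edge_geodetic_set S : Prop :=
  forall x y, adj x y -> exists u v w,
    [/\ u \in S, v \in S, u != v, geodesic u v w & edge_on x y w].

(* The condition P v u = rev (P u v) says that only one path is chosen for each
   unordered pair {u, v}. *)
Definition strong_edge_geodetic_set S : Prop :=
  exists P : G -> G -> seq G,
    (forall u v, u \in S -> v \in S -> u != v ->
       geodesic u v (P u v) /\ P v u = rev (P u v)) /\
    (forall x y, adj x y -> exists u v,
       [/\ u \in S, v \in S, u != v & edge_on x y (P u v)]).

Definition meg_set S : Prop :=
  forall x y, adj x y -> exists u v,
    [/\ u \in S, v \in S, u != v &
        forall w, geodesic u v w -> edge_on x y w].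

Definition min_card (Q : {set G} -> Prop) (k : nat) : Prop :=
  (exists2 S, Q S & #|S| = k) /\ forall S, Q S -> k <= #|S|.

Definition geodetic_number_is : nat -> Prop := min_card geodetic_set.
Definition edge_geodetic_number_is : nat -> Prop := min_card edge_geodetic_set.
Definition strong_edge_geodetic_number_is : nat -> Prop :=
  min_card strong_edge_geodetic_set.
Definition meg_number_is : nat -> Prop := min_card meg_set.

End Geodetic.

(* Main.v *)
Require Import Defs.
From mathcomp Require Import all_boot zify.

Set Implicit Arguments.
Unset Strict Implicit.
Unset Printing Implicit Defensive.

(** For b = c = d = 2 the complete graph on two vertices works. In all other
    cases the graph is built in levels, every edge joining consecutive levels
    except for the edges of one clique.

    On levels 0 to h there is a chain of even cycles glued at opposite
    vertices, with one or two vertices on each level. It starts with a pendant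
    edge if o = 0 and with a 6-cycle if o = 1, followed by k 4-cycles.
    The single vertex of level h, the hub, is joined to the sink, on level
    h + 3, by N >= 2 branches: paths hub - a_j - b_j - sink of length 3.
    Finally q clones of b_0 (adjacent to a_0 and to the sink) form a clique
    together with b_0. The parameters are
    q = b - 3 (so 0 if b = 2), N = c - 1 - q, and d - c = 2 k + o.

    - Geodetic number 2. Every vertex, and every edge outside the clique, lies
      on a shortest path from the source, on level 0, to the sink.
    - Edge-geodetic number 2 or q + 3. If q > 0, then b_0 and its clones are
      adjacent twins, hence all forced; one vertex before the hub and one more
      vertex on the right are needed besides.
    - Strong edge-geodetic number N + q + 1. A shortest path that crosses a
      branch from end to end joins the sink to a vertex that is not beyond the
      hub, and it crosses only one branch. Hence every branch without a chosen
      vertex uses up a chosen vertex on the left, and if there is such a branch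
      the sink is chosen as well (crossing_ends, seg_lower). Conversely the
      source and all of level h + 2 suffice: the left sides of the cycles are
      covered by the path to b_0 and the right sides by the path to b_1.
    - Monitoring number N + q + 2 k + o + 1. Folding one side of a cycle, a
      branch or the pendant edge onto another part of the graph is a
      homomorphism that fixes all other vertices and avoids some edge, so a
      monitoring set contains a vertex that the folding moves (meg_moved). Each
      4-cycle costs 2 in this way, and the 6-cycle costs 1 more than the pendant
      edge, whereas for the strong number two paths through the chain cover them
      at no cost; this is how d - c grows.

    Vertices are forced by two facts on a map f that fixes the ends of a
    shortest path. If f maps edges to edges or vertices, it cannot contract an
    edge of the path (geodesic_not_contracted); if f maps edges to edges, it
    maps the path to another shortest path (geodesic_map). *)

(** * Distance and shortest paths *)

Lemma zip_beheadP (T : eqType) (x0 x y : T) (w : seq T) :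
  reflect (exists2 i, i.+1 < size w & nth x0 w i = x /\ nth x0 w i.+1 = y)
          ((x, y) \in zip w (behead w)).
Proof.
have szE : size (zip w (behead w)) = (size w).-1.
  by rewrite size_zip size_behead; lia.
apply: (iffP idP) => [/(nthP (x0, x0))[i] | [i lt_i [xE yE]]].
  rewrite szE => lt_i; rewrite nth_zip_cond szE lt_i nth_behead => -[<- <-].
  by exists i; first lia.
apply/(nthP (x0, x0)); exists i; first by rewrite szE; lia.
by rewrite nth_zip_cond szE ifT ?nth_behead ?xE ?yE //; lia.
Qed.

Lemma edge_onC (G : sgraph) (x y : G) (w : seq G) :
  edge_on x y w = edge_on y x w.
Proof. by rewrite /edge_on orbC. Qed.

Section Distance.

Variable G : sgraph.
Implicit Types (x y z s t : G) (p w : seq G).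

Lemma walk_cons s t w :
  walk s t w -> exists p, [/\ w = s :: p, path (@adj G) s p & last s p = t].
Proof. by case: w => // x p /and3P[/eqP-> xp /eqP lp]; exists p. Qed.

Lemma walk_rev s t w : walk s t w -> walk t s (rev w).
Proof.
case/walk_cons=> p [-> sp <-]; rewrite lastI rev_rcons /walk eqxx.
rewrite rev_path (eq_path (e' := @adj G)) ?sp; last by move=> a b; exact: adj_sym.
by case: (p) => [|a p'] /=; rewrite ?eqxx // rev_cons last_rcons eqxx.
Qed.

Lemma geodesic_rev s t w : geodesic s t w -> geodesic t s (rev w).
Proof.
move=> [sw min_w]; split=> [|w' /walk_rev/min_w]; first exact: walk_rev.
by rewrite !size_rev.
Qed.

(** A boolean predicate, so that the distance can be defined by [ex_minn]. *)
Definition reach x y n : bool :=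
  [exists p : n.-tuple G, path (@adj G) x p && (last x p == y)].

Lemma reachP x y n :
  reflect (exists p, [/\ path (@adj G) x p, last x p = y & size p = n])
          (reach x y n).
Proof.
apply: (iffP existsP) => [[p /andP[xp /eqP lp]] | [p [xp lp /eqP sp]]].
  by exists p; rewrite xp lp size_tuple.
by exists (Tuple sp); rewrite xp lp eqxx.
Qed.

Hypothesis Gc : connected_graph G.

Lemma reach_ex x y : exists n, reach x y n.
Proof.
by have /connectP[p xp ->] := Gc x y; exists (size p); apply/reachP; exists p.
Qed.

Definition dist x y := ex_minn (reach_ex x y).

Lemma dist_path x y :
  exists p, [/\ path (@adj G) x p, last x p = y & size p = dist x y].
Proof. by rewrite /dist; case: ex_minnP => n /reachP. Qed.

Lemma dist_le x p : path (@adj G) x p -> dist x (last x p) <= size p.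
Proof.
move=> xp; rewrite /dist; case: ex_minnP => n _; apply.
by apply/reachP; exists p.
Qed.

Lemma dist_walk s t w : walk s t w -> (dist s t).+1 <= size w.
Proof. by case/walk_cons=> p [-> sp <-]; rewrite ltnS dist_le. Qed.

Lemma geodesicE s t w :
  geodesic s t w <-> walk s t w /\ size w = (dist s t).+1.
Proof.
split=> [[sw min_w] | [sw szw]]; split=> //; last first.
  by move=> w' /dist_walk; rewrite szw.
have [p [sp lp szp]] := dist_path s t; apply/eqP; rewrite eqn_leq dist_walk // andbT.
rewrite -szp; apply: (min_w (s :: p)).
by rewrite /walk eqxx sp lp eqxx.
Qed.

Lemma geodesic_ex s t : exists w, geodesic s t w.
Proof.
have [p [sp lp szp]] := dist_path s t; exists (s :: p).
by apply/geodesicE; rewrite /walk eqxx sp lp eqxx /= szp.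
Qed.

Lemma dist_sym x y : dist x y = dist y x.
Proof.
suff le u v : dist u v <= dist v u by apply/eqP; rewrite eqn_leq !le.
have [w /geodesicE[/walk_rev/dist_walk]] := geodesic_ex v u.
by rewrite size_rev => le_w szw; rewrite -ltnS -szw.
Qed.

Lemma dist_tri y x z : dist x z <= dist x y + dist y z.
Proof.
have [p [xp lp <-]] := dist_path x y; have [r [yr lr <-]] := dist_path y z.
rewrite -size_cat -lr -{1}lp -last_cat dist_le // cat_path xp lp.
exact: yr.
Qed.

Lemma distxx x : dist x x = 0.
Proof. by apply/eqP; rewrite -leqn0 (@dist_le x [::]). Qed.

Lemma dist_eq0 x y : dist x y = 0 -> x = y.
Proof. by have [[|a p] [_ <- <-]] := dist_path x y. Qed.

Lemma dist_adj x y : adj x y -> dist x y <= 1.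
Proof. by move=> xy; rewrite (@dist_le x [:: y]) //= xy. Qed.

Lemma dist_gt1 x y : x != y -> ~~ adj x y -> 1 < dist x y.
Proof.
have [[|a [|b p]] [/= + <- <-]] := dist_path x y; rewrite ?eqxx //.
by rewrite andbT => ->.
Qed.

Lemma dist_pred s x : x != s -> exists2 z, adj z x & dist s x = (dist s z).+1.
Proof.
have [p [+ + szp]] := dist_path s x; case/lastP: p szp => [|p z] szp.
  by move=> _ /= ->; rewrite eqxx.
rewrite rcons_path last_rcons => /andP[sp zx] zE xs; rewrite zE in zx.
exists (last s p) => //; apply/eqP; rewrite eqn_leq.
have le1 := dist_adj zx; have := dist_tri (last s p) s x.
by move: (dist_le sp); rewrite -szp size_rcons; lia.
Qed.

(** The walk has length [dist s t], and its two pieces on either side of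
    position [i] are at least as long as the distances that they span, so both
    bounds are attained. *)
Lemma geodesic_nth s t w i : geodesic s t w -> i <= dist s t ->
  dist s (nth s w i) = i /\ dist (nth s w i) t = dist s t - i.
Proof.
case/geodesicE=> /walk_cons[p [-> sp lp]] [szp] le_i.
have xE : last s (take i p) = nth s (s :: p) i.
  rewrite (last_nth s) size_takel ?szp //.
  by rewrite -(nth_take s (ltnSn i) (s :: p)) /=.
have := sp; rewrite -{1}(cat_take_drop i p) cat_path xE => /andP[].
move=> /dist_le; rewrite xE => le1 /dist_le.
have -> : last (nth s (s :: p) i) (drop i p) = t.
  by rewrite -xE -last_cat cat_take_drop.
move: le1; rewrite size_takel ?szp // size_drop szp.
by have := dist_tri (nth s (s :: p) i) s t; lia.
Qed.

Lemma geodesic_edge s t x y w : geodesic s t w -> edge_on x y w ->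
  dist s t = dist s x + 1 + dist y t \/ dist s t = dist s y + 1 + dist x t.
Proof.
move=> gw; have szw : size w = (dist s t).+1 by case/geodesicE: gw.
case/orP=> /(zip_beheadP s)[i]; rewrite szw ltnS => lt_i [<- <-]; [left | right].
  rewrite (geodesic_nth gw (ltnW lt_i)).1 (geodesic_nth gw lt_i).2; lia.
rewrite (geodesic_nth gw (ltnW lt_i)).1 (geodesic_nth gw lt_i).2; lia.
Qed.

Lemma dist_through_sym s t x y :
  dist s t = dist s x + 1 + dist y t -> dist t s = dist t y + 1 + dist x s.
Proof.
by rewrite (dist_sym t s) (dist_sym t y) (dist_sym x s) => ->; lia.
Qed.

Lemma edge_geodesic s t x y : adj x y -> dist s t = dist s x + 1 + dist y t ->
  exists2 w, geodesic s t w & edge_on x y w.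
Proof.
move=> xy dE; have [p [sp lp szp]] := dist_path s x.
have [r [yr lr szr]] := dist_path y t.
exists (s :: p ++ y :: r).
  apply/geodesicE; rewrite /walk eqxx cat_path sp lp /= xy yr.
  by rewrite last_cat /= lr eqxx size_cat /= szp szr; lia.
apply/orP; left; apply/(zip_beheadP s); exists (size p).
  by rewrite /= size_cat /=; lia.
split; last by rewrite /= nth_cat ltnn subnn.
by rewrite -cat_cons nth_cat /= ltnSn -[nth _ _ _]last_nth.
Qed.

Lemma vertex_geodesic s t x : dist s t = dist s x + dist x t ->
  exists2 w, geodesic s t w & x \in w.
Proof.
move=> dE; have [p [sp lp szp]] := dist_path s x.
have [r [yr lr szr]] := dist_path x t.
exists (s :: p ++ r); last by rewrite -cat_cons mem_cat -{1}lp mem_last.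
apply/geodesicE; rewrite /walk eqxx cat_path sp lp yr /=.
by rewrite last_cat lp lr eqxx size_cat /= szp szr; lia.
Qed.

Lemma edge_on_mem x y w : edge_on x y w -> x \in w /\ y \in w.
Proof.
by case/orP=> /(zip_beheadP x)[i lt_i [<- <-]]; rewrite !mem_nth //; lia.
Qed.

Lemma edge_on_rev x y w : edge_on x y (rev w) = edge_on x y w.
Proof.
suff imp r : edge_on x y r -> edge_on x y (rev r).
  by apply/idP/idP=> [/imp|/imp//]; rewrite revK.
rewrite (edge_onC _ _ (rev r)).
have lt_r i : i.+1 < size r -> (size r - i.+2).+1 < size (rev r).
  by rewrite size_rev; lia.
have rE i : i.+1 < size r -> nth x (rev r) (size r - i.+2) = nth x r i.+1
    /\ nth x (rev r) (size r - i.+2).+1 = nth x r i.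
  by move=> lt_i; rewrite !nth_rev; [split; congr nth; lia | lia | lia].
case/orP=> /(zip_beheadP x)[i lt_i [xE yE]]; have [e1 e2] := rE _ lt_i; apply/orP.
  left; apply/(zip_beheadP x); exists (size r - i.+2); first exact: lt_r.
  by rewrite e1 e2.
right; apply/(zip_beheadP x); exists (size r - i.+2); first exact: lt_r.
by rewrite e1 e2.
Qed.

Lemma geodesic_at s t x w : geodesic s t w -> x \in w -> nth s w (dist s x) = x.
Proof.
move=> gw /(nthP s)[i lt_i <-]; case/geodesicE: (gw) => _ szw.
by rewrite (geodesic_nth gw _).1 // -ltnS -szw.
Qed.

Lemma geodesic_choice :
  exists R : G -> G -> seq G, forall s t, geodesic s t (R s t).
Proof.
have ex st : exists w, walk st.1 st.2 w && (size w == (dist st.1 st.2).+1).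
  have [w /geodesicE[sw szw]] := geodesic_ex st.1 st.2.
  by exists w; rewrite sw szw eqxx.
exists (fun s t => xchoose (ex (s, t))) => s t; apply/geodesicE.
by case/andP: (xchooseP (ex (s, t))) => ? /eqP.
Qed.

(** * Homomorphisms and shortest paths *)

Definition graph_hom (f : G -> G) := forall x y, adj x y -> adj (f x) (f y).

Definition weak_hom (f : G -> G) :=
  forall x y, adj x y -> f x = f y \/ adj (f x) (f y).

Lemma dist_weak_hom f x y : weak_hom f -> dist (f x) (f y) <= dist x y.
Proof.
move=> fh; have [p [+ <- <-]] := dist_path x y.
elim: p x => [|z p IHp] x /=; first by rewrite distxx.
case/andP=> /fh xz /IHp le_p; case: xz => [->|/dist_adj le1]; first lia.
by have := dist_tri (f z) (f x) (f (last z p)); lia.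
Qed.

(** The image of the path would be a walk between the same ends with at least
    one step less. *)
Lemma geodesic_not_contracted f s t x y w : weak_hom f -> f s = s -> f t = t ->
  geodesic s t w -> edge_on x y w -> f x <> f y.
Proof.
move=> fh fs ft gw xyw fxy; have := geodesic_edge gw xyw.
have := dist_tri (f x) s t.
have := dist_weak_hom s x fh; have := dist_weak_hom s y fh.
have := dist_weak_hom x t fh; have := dist_weak_hom y t fh.
by rewrite fs ft fxy; lia.
Qed.

(** The form in which non-contraction gives lower bounds: a vertex that no
    edge-geodetic set can avoid is found by contracting an edge while moving few
    vertices. *)
Lemma edge_geodetic_moved (S : {set G}) f x y : edge_geodetic_set S ->
  weak_hom f -> adj x y -> f x = f y -> exists2 s, s \in S & f s != s.
Proof.
move=> Sg fh /Sg[s [t [w [sS tS _ gw xyw]]]] fxy.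
have [fs|fs] := eqVneq (f s) s; last by exists s.
have [ft|ft] := eqVneq (f t) t; last by exists t.
by have := geodesic_not_contracted fh fs ft gw xyw.
Qed.

Lemma geodesic_map f s t w : graph_hom f ->
  f s = s -> f t = t -> geodesic s t w -> geodesic s t (map f w).
Proof.
move=> fh fs ft /geodesicE[/walk_cons[p [-> sp lp]] szp]; apply/geodesicE.
rewrite size_map szp /= /walk fs eqxx -{1}fs path_map -[X in last X]fs last_map.
rewrite lp ft eqxx; split=> //; rewrite andbT.
by apply: sub_path sp => a b /fh.
Qed.

(** If [f] fixed the pair that monitors the edge, then it would map a shortest
    path between them to one that avoids [x]. *)
Lemma meg_moved (S : {set G}) f x y : meg_set S -> graph_hom f -> adj x y ->
  (forall z, f z != x) -> exists2 s, s \in S & f s != s.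
Proof.
move=> Sg fh /Sg[s [t [sS tS _ mon]]] fx.
have [fs|fs] := eqVneq (f s) s; last by exists s.
have [ft|ft] := eqVneq (f t) t; last by exists t.
have [w /(geodesic_map fh fs ft)/mon] := geodesic_ex s t.
have Nx : x \notin map f w by apply/mapP => -[z _ xE]; case/eqP: (fx z).
case/orP=> /(zip_beheadP s)[i lt_i [xE yE]]; case/negP: Nx.
  by rewrite -xE mem_nth //; lia.
by rewrite -yE mem_nth //; lia.
Qed.

(** * Monitored edges *)

Definition monitored s t x y := forall w, geodesic s t w -> edge_on x y w.

Lemma monitored_sym s t x y : monitored s t x y -> monitored t s x y.
Proof. by move=> mon w /geodesic_rev/mon; rewrite edge_on_rev. Qed.

Lemma monitoredC s t x y : monitored s t x y -> monitored s t y x.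
Proof. by move=> mon w /mon; rewrite edge_onC. Qed.

Lemma geodesic_adj s t w : adj s t -> geodesic s t w -> w = [:: s; t].
Proof.
move=> st /geodesicE[/walk_cons[p [-> sp lp]] [szp]].
have : size p <= 1 by rewrite szp dist_adj.
case: p sp lp {szp} => [_ st'|a [|//] _ /= -> //].
by move: st; rewrite -st' adj_irr.
Qed.

Lemma monitored_adj s t : adj s t -> monitored s t s t.
Proof. by move=> st w /(geodesic_adj st)->; rewrite /edge_on !inE eqxx. Qed.

Lemma dist1_adj s t : dist s t = 1 -> adj s t.
Proof.
move=> st; have Nst : s != t by apply/eqP=> E; move: st; rewrite E distxx.
by apply: contraTT (leqnn 1) => /(dist_gt1 Nst); rewrite st.
Qed.

Lemma monitored_middle s t z : s != t -> ~~ adj s t -> adj s z -> adj z t ->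
    (forall y, adj s y -> adj y t -> y = z) ->
  monitored s t s z /\ monitored s t z t.
Proof.
move=> Nst Ast sz zt Uz; suff gE w : geodesic s t w -> w = [:: s; z; t].
  by split=> w /gE->; rewrite /edge_on /= !inE !eqxx ?orbT.
move=> /geodesicE[/walk_cons[p [-> sp lp]] [szp]].
have d2 : dist s t = 2.
  have := dist_gt1 Nst Ast; have := dist_tri z s t.
  by have := dist_adj sz; have := dist_adj zt; lia.
move: szp sp lp; rewrite d2; case: p => [|a [|b [|? ?]]] //= _.
by case/and3P=> sa ab _ bt; rewrite bt in ab *; rewrite (Uz a sa ab).
Qed.

(** * Gradings *)

Section Grading.

Variable lv : G -> nat.
Hypothesis lv_adj : forall x y, adj x y -> lv y <= (lv x).+1.

Lemma grading_dist x y : lv y <= lv x + dist x y.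
Proof.
have [p [+ <- <-]] := dist_path x y.
elim: p x => [|z p IHp] x /=; first by rewrite addn0.
by case/andP=> /lv_adj xz /IHp; lia.
Qed.

(** A geodesic along which the grading rises as fast as possible meets each
    level exactly once. The two distances are recorded because they pin down the
    vertices of the path next to its ends. *)
Lemma graded_edge s t w i : geodesic s t w -> lv t = lv s + dist s t ->
    lv s <= i < lv t ->
  exists x y, [/\ lv x = i, lv y = i.+1,
    dist s x = i - lv s, dist y t = lv t - i.+1 & 
    [/\ adj x y, x \in w, y \in w & edge_on x y w]].
Proof.
move=> gw lvE i_w; have := gw; case/geodesicE=> ww szw.
pose j := i - lv s; have lt_j : j < dist s t by rewrite /j; lia.
have [dx1 dx2] := geodesic_nth gw (ltnW lt_j).
have [dy1 dy2] := geodesic_nth gw lt_j.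
set x := nth s w j in dx1 dx2; set y := nth s w j.+1 in dy1 dy2.
have := grading_dist s x; have := grading_dist x t; rewrite dx1 dx2 => le1 le2.
have := grading_dist s y; have := grading_dist y t; rewrite dy1 dy2 => le3 le4.
exists x, y; rewrite dx1 dy2; split;
  try (rewrite /j in lt_j le1 le2 le3 le4 *; lia).
split; rewrite ?mem_nth ?szw //; try lia.
  case/walk_cons: ww => p [wE sp _]; rewrite /x /y wE /=.
  by move/(pathP s): sp; apply; rewrite wE in szw; case: szw => ->.
by apply/orP; left; apply/(zip_beheadP s); exists j; rewrite ?szw.
Qed.

End Grading.

(** * Covering sets and their cardinality *)

(** The choice of paths must be invariant under reversal, which is arranged by
    orienting each pair; only the paths of oriented pairs need to cover. *)
Lemma strong_edge_geodeticI (S : {set G}) (before : rel G)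
    (Q : G -> G -> seq G) :
    (forall u v, u != v -> before v u = ~~ before u v) ->
    (forall u v, u \in S -> v \in S -> geodesic u v (Q u v)) ->
    (forall x y, adj x y -> exists u v,
       [/\ u \in S, v \in S, u != v, before u v & edge_on x y (Q u v)]) ->
  strong_edge_geodetic_set S.
Proof.
move=> bC Qg Qe; exists (fun u v => if before u v then Q u v else rev (Q v u)).
split=> [u v uS vS Nuv | x y /Qe[u [v [uS vS Nuv buv uvQ]]]]; last first.
  by exists u, v; rewrite buv.
rewrite (bC _ _ Nuv); case: (before u v) => /=; split; rewrite ?revK //.
  exact: Qg.
by apply/geodesic_rev/Qg.
Qed.

End Distance.

(** Cardinalities are bounded by labelling the vertices with numbers below [d];
    the same labelling serves for the lower and for the upper bound. *)
Lemma card_ge_labels (T : finType) (S : {set T}) (h : T -> nat) d :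
  (forall c, c < d -> exists2 s, s \in S & h s = c) -> d <= #|S|.
Proof.
move=> hS; rewrite cardE -(size_map h) -(size_iota 0 d).
apply: uniq_leq_size (iota_uniq _ _) _ => c; rewrite mem_iota => /hS[s sS <-].
by rewrite map_f // mem_enum.
Qed.

Lemma card_le_labels (T : finType) (S : {set T}) (h : T -> nat) d :
  {in S, forall s, h s < d} -> {in S &, injective h} -> #|S| <= d.
Proof.
move=> hS h_inj; rewrite cardE -(size_map h) -(size_iota 0 d).
apply: uniq_leq_size => [|c /mapP[s]]; last first.
  by rewrite mem_enum mem_iota => /hS ? ->.
by rewrite map_inj_in_uniq ?enum_uniq // => a b; rewrite !mem_enum; exact: h_inj.
Qed.

Lemma edge_geodetic_gt1 (G : sgraph) (S : {set G}) (x y : G) :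
  adj x y -> edge_geodetic_set S -> 1 < #|S|.
Proof.
move=> xy /(_ x y xy)[s [t [w [sS tS st _ _]]]].
by apply/card_gt1P; exists s, t.
Qed.

Lemma strong_edge_geodetic_weak (G : sgraph) (S : {set G}) :
  strong_edge_geodetic_set S -> edge_geodetic_set S.
Proof.
move=> [P [gP eP]] x y /eP[u [v [uS vS uv xyP]]].
by exists u, v, (P u v); split=> //; case: (gP _ _ uS vS uv).
Qed.

Lemma meg_edge_geodetic (G : sgraph) (S : {set G}) :
  connected_graph G -> meg_set S -> edge_geodetic_set S.
Proof.
move=> Gc mS x y /mS[u [v [uS vS uv mon]]].
by have [w gw] := geodesic_ex Gc u v; exists u, v, w; split=> //; exact: mon.
Qed.

(** * The complete graph on two vertices *)

Section K2.

Let neq_sym : symmetric (fun x y : bool => x != y).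
Proof. by move=> x y; rewrite eq_sym. Qed.
Let neq_irr : irreflexive (fun x y : bool => x != y).
Proof. by move=> x; rewrite eqxx. Qed.

Definition K2 : sgraph := SGraph neq_sym neq_irr.

Lemma K2_numbers :
  [/\ connected_graph K2, geodetic_number_is K2 2, edge_geodetic_number_is K2 2,
      strong_edge_geodetic_number_is K2 2 & meg_number_is K2 2].
Proof.
have Kc : connected_graph K2.
  move=> x y; have [->|xy] := eqVneq x y; first exact: connect0.
  exact: connect1.
have card2 : #|[set: K2]| = 2 by rewrite cardsT card_bool.
have gK (x y : K2) : x != y -> geodesic x y [:: x; y].
  move=> xy; have [w gw] := geodesic_ex Kc x y.
  by rewrite -(geodesic_adj Kc _ gw).
have onK (x y : K2) : edge_on x y [:: x; y] by rewrite /edge_on !inE eqxx.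
have eK (S : {set K2}) : edge_geodetic_set S -> 2 <= #|S|.
  exact: (@edge_geodetic_gt1 K2 S true false).
have full (Q : {set K2} -> Prop) :
    Q [set: K2] -> (forall S, Q S -> 1 < #|S|) -> min_card Q 2.
  by move=> QT Q2; split=> //; exists [set: K2].
split=> //; apply: full.
- move=> x; exists true, false, [:: true; false]; rewrite !inE; split=> //.
    exact: gK.
  by case: x.
- by move=> S /(_ true)[u [v [w [uS vS uv _ _]]]]; apply/card_gt1P; exists u, v.
- move=> x y xy; exists x, y, [:: x; y]; rewrite !inE; split=> //; exact: gK.
- exact: eK.
- exists (fun x y => [:: x; y]); split=> [x y _ _ xy | x y xy].
    by split=> //; exact: gK.
  by exists x, y; rewrite !inE.
- by move=> S /strong_edge_geodetic_weak/eK.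
- move=> x y xy; exists x, y; rewrite !inE; split=> // w gw.
  by rewrite (geodesic_adj Kc xy gw).
- by move=> S /(meg_edge_geodetic Kc)/eK.
Qed.

End K2.

(** * The layered graphs *)

Section Family.

Variables (o : bool) (k N q : nat).

(** A pendant edge of length 1 or a 6-cycle of length 3, then 4-cycles of length
    2 each. *)
Definition hub := k.*2 + o.*2 + 1.

(** The levels with two vertices, labelled 0 and 1. The even levels strictly
    between the source and the hub are the middles of the 4-cycles, except that
    for [o] levels 1 and 2 form a 6-cycle together with levels 0 and 3. *)
Definition paired i := (0 < i < hub) && (~~ odd i || o && (i == 1)).
Definition single i := [&& ~~ paired i, i != hub.+1 & i != hub.+2].

(** [slot i a] says that level [i] has a vertex with label [a]. On level
    [hub.+2] the label [j < N] stands for the vertex b_j, and the labels from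
    [N] on are the clones of b_0. *)
Definition slot i a :=
  (i <= hub.+3) && [|| a == 0, paired i && (a == 1),
    (i == hub.+1) && (a < N) | (i == hub.+2) && (a < N + q)].

(** Adjacency of label [a] on level [i] and label [b] on level [i.+1]: two
    consecutive levels are completely joined if one of them is a singleton, and
    matched by label otherwise, the clones being attached to a_0. *)
Definition up i a b :=
  [|| single i, single i.+1, a == b | [&& i == hub.+1, a == 0 & N <= b]].

(** The labels of b_0 and of its clones. *)
Definition inclique a := (a == 0) || (N <= a).

Definition adjn i a j b :=
  [|| (j == i.+1) && up i a b, (i == j.+1) && up j b a |
      [&& i == hub.+2, j == i, a != b, inclique a & inclique b]].

Definition vert : finType := {x : 'I_hub.+4 * 'I_(N + q).+1 | slot x.1 x.2}.
Definition lev (x : vert) : nat := (val x).1.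
Definition lab (x : vert) : nat := (val x).2.

Definition adjv : rel vert := fun x y => adjn (lev x) (lab x) (lev y) (lab y).

Lemma adjv_sym : symmetric adjv.
Proof. by move=> x y; rewrite /adjv /adjn; lia. Qed.
Lemma adjv_irr : irreflexive adjv.
Proof. by move=> x; rewrite /adjv /adjn; lia. Qed.

Definition layered := SGraph adjv_sym adjv_irr.

Hypothesis hN : 1 < N.

Lemma hubP : odd hub /\ o.*2 < hub.
Proof. rewrite /hub; lia. Qed.

Lemma slotP x : slot (lev x) (lab x).
Proof. exact: (valP x). Qed.

Lemma vert_eq x y : lev x = lev y -> lab x = lab y -> x = y.
Proof.
case: x y => [[i a] ia] [[j b] jb] /= ij ab; apply/val_inj => /=.
by congr (_, _); apply/val_inj.
Qed.

Definition root : vert := Sub (ord0 : 'I_hub.+4, ord0 : 'I_(N + q).+1) isT.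
(** A total constructor spares proof arguments; outside the slots it returns
    [root]. *)
Definition vtx i a : vert := insubd root (inord i, inord a).

Lemma slot_lt i a : slot i a -> i < hub.+4 /\ a < (N + q).+1.
Proof. by have := hubP; rewrite /slot /paired; lia. Qed.

Lemma val_vtx i a : slot i a -> lev (vtx i a) = i /\ lab (vtx i a) = a.
Proof.
move=> ia; have [lti lta] := slot_lt ia.
by rewrite /lev /lab /vtx val_insubd /= !inordK // ia /= !inordK.
Qed.

Lemma lev_vtx i a : slot i a -> lev (vtx i a) = i.
Proof. by case/val_vtx. Qed.
Lemma lab_vtx i a : slot i a -> lab (vtx i a) = a.
Proof. by case/val_vtx. Qed.

Ltac level_lia := have := hubP; rewrite /adjn /up /single /slot /paired /inclique; lia.

(** The widths of consecutive levels never decrease except to 1, so a label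
    either survives on the next level or that level is a singleton. *)
Lemma slot_up i a : slot i a -> i < hub.+3 ->
  exists2 b, slot i.+1 b & up i a b.
Proof.
move=> ia lt_i; case: (boolP (slot i.+1 a)) => [iSa | Nslot].
  by exists a; rewrite // /up eqxx !orbT.
exists 0; first by rewrite /slot lt_i.
suff: single i.+1 by rewrite /up => ->; rewrite orbT.
move: Nslot ia; level_lia.
Qed.

Lemma slot_down i b : slot i.+1 b -> exists2 a, slot i a & up i a b.
Proof.
move=> iSb; case: (boolP (slot i b)) => [ib | Nslot].
  by exists b; rewrite // /up eqxx !orbT.
exists 0; first by move: iSb; rewrite /slot /=; lia.
suff : single i || (i == hub.+1) && (N <= b) by rewrite /up; lia.
move: Nslot iSb; level_lia.
Qed.

Lemma single_root : single 0. Proof. by level_lia. Qed.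
Lemma single_hub : single hub. Proof. by level_lia. Qed.
Lemma single_end : single hub.+3. Proof. by level_lia. Qed.

Lemma slot_single i a : slot i a -> single i -> a = 0.
Proof. by level_lia. Qed.

Lemma slot0 i : i <= hub.+3 -> slot i 0.
Proof. by rewrite /slot => ->. Qed.

Lemma vtx_eq (x : layered) i a : slot i a -> lev x = i -> lab x = a -> x = vtx i a.
Proof. by move=> ia xi xa; apply: vert_eq; rewrite ?lev_vtx ?lab_vtx. Qed.

Lemma single_eq (x y : layered) : lev x = lev y -> single (lev x) -> x = y.
Proof.
move=> xy sx; apply: vert_eq => //.
rewrite (slot_single (slotP x) sx) (slot_single (slotP y)) //.
by rewrite -xy.
Qed.

Lemma adj_cases (x y : layered) : adj x y ->
  [\/ lev y = (lev x).+1 /\ up (lev x) (lab x) (lab y),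
     lev x = (lev y).+1 /\ up (lev y) (lab y) (lab x) |
     [/\ lev x = hub.+2, lev y = hub.+2, lab x != lab y, inclique (lab x)
       & inclique (lab y)]].
Proof.
rewrite /adj /= /adjv => /or3P[/andP[/eqP-> ->]|/andP[/eqP-> ->]|].
- by constructor 1.
- by constructor 2.
- by case/and5P=> /eqP-> /eqP-> -> -> ->; constructor 3.
Qed.

Lemma adj_up (x y : layered) :
  lev y = (lev x).+1 -> up (lev x) (lab x) (lab y) -> adj x y.
Proof. by rewrite /adj /= /adjv /adjn => -> ->; rewrite eqxx. Qed.

Lemma adj_up_inv (x y : layered) :
  adj x y -> lev y = (lev x).+1 -> up (lev x) (lab x) (lab y).
Proof. by case/adj_cases=> [[]|[]|[]] //; lia. Qed.

Lemma lev_adj (x y : layered) : adj x y -> lev y <= (lev x).+1.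
Proof. by case/adj_cases=> [[]|[]|[]]; lia. Qed.

Lemma lev_le (x : layered) : lev x <= hub.+3.
Proof. by have /andP[] := slotP x. Qed.

Lemma lev_up (x : layered) : lev x < hub.+3 ->
  exists2 y : layered, adj x y & lev y = (lev x).+1.
Proof.
case/(slot_up (slotP x))=> b ib xb; exists (vtx (lev x).+1 b).
  by apply: adj_up; rewrite ?lev_vtx ?lab_vtx.
by rewrite lev_vtx.
Qed.

Lemma lev_down (x : layered) : 0 < lev x ->
  exists2 y : layered, adj y x & lev x = (lev y).+1.
Proof.
move=> x_gt0; have := slotP x; rewrite -(prednK x_gt0).
case/slot_down=> a ia xa; exists (vtx (lev x).-1 a).
  by apply: adj_up; rewrite ?lev_vtx ?lab_vtx ?prednK.
by rewrite lev_vtx ?prednK.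
Qed.

Lemma layered_connected : connected_graph layered.
Proof.
have sym : connect_sym (@adj layered) by apply: sym_connect_sym; exact: adjv_sym.
suff to_root (x : layered) : connect (@adj layered) x root.
  by move=> x y; rewrite (connect_trans (to_root x)) // sym.
have [n] := ubnP (lev x); elim: n x => // n IHn x le_x.
have [x0 | x_gt0] := posnP (lev x).
  by rewrite (@single_eq x root) ?x0 ?single_root //.
have [y yx xy] := lev_down x_gt0.
apply: connect_trans (IHn y _); last by lia.
by rewrite sym connect1.
Qed.

Local Notation Gc := layered_connected.
Local Notation d := (dist layered_connected).

Lemma dist_up (x : layered) j : lev x <= j <= hub.+3 ->
  exists2 y, lev y = j & d x y <= j - lev x.
Proof.
elim: j => [|j IHj] le_j.
  by exists x; rewrite ?distxx //; lia.
have [xj|lt_x] := eqVneq (lev x) j.+1; first by exists x; rewrite ?distxx.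
have [|y yj le_y] := IHj; first by lia.
have [|z yz zj] := @lev_up y; first by lia.
exists z; first by lia.
by have := dist_tri Gc y x z; have := dist_adj Gc yz; lia.
Qed.

Lemma dist_down (x : layered) j : j <= lev x ->
  exists2 y, lev y = j & d y x <= lev x - j.
Proof.
move: {2}(lev x - j) (erefl (lev x - j)) => n; elim: n j => [|n IHn] j nE le_j.
  by exists x; rewrite ?distxx //; lia.
have [||y yj le_y] := IHn j.+1; try by lia.
have [|z zy zj] := @lev_down y; first by lia.
exists z; first by lia.
by have := dist_tri Gc y z x; have := dist_adj Gc zy; lia.
Qed.

(** Level-monotone paths from both vertices to a singleton level end at the same
    vertex, so they can be concatenated. *)
Lemma dist_single (x y : layered) j : single j -> lev x <= j <= lev y ->
  lev y = lev x + d x y.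
Proof.
move=> sj le_j; have := grading_dist Gc lev_adj x y; have := lev_le y => yH.
have [|z zj le_z] := @dist_up x j; first lia.
have [|t tj le_t] := @dist_down y j; first lia.
have zt : z = t by apply: single_eq; rewrite zj.
rewrite -zt in le_t; have := dist_tri Gc z x y; lia.
Qed.

(** * Geodesics from the source to the sink *)

Definition source : layered := root.
Definition sink : layered := vtx hub.+3 0.

Lemma lev_end : lev sink = hub.+3.
Proof. by rewrite lev_vtx ?slot0. Qed.

Lemma dist_root x : d source x = lev x.
Proof. by rewrite (@dist_single source x 0) ?single_root. Qed.

Lemma dist_end x : hub.+3 = lev x + d x sink.
Proof.
by rewrite -(@dist_single x sink hub.+3) ?single_end ?lev_end ?lev_le ?leqnn.
Qed.

Lemma root_end : source != sink.
Proof. by apply/eqP=> /(congr1 (@lev)); rewrite lev_end. Qed.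

Lemma geodetic_ends : geodetic_set [set source; sink].
Proof.
move=> x; have [|w gw xw] := @vertex_geodesic _ Gc source sink x.
  by rewrite !dist_root lev_end -dist_end.
by exists source, sink, w; rewrite !inE !eqxx orbT root_end.
Qed.

Lemma ends_cover (x y : layered) : adj x y -> lev y = (lev x).+1 ->
  exists2 w, geodesic source sink w & edge_on x y w.
Proof.
move=> xy yx; apply: (@edge_geodesic _ Gc) => //.
by rewrite !dist_root lev_end (dist_end y); lia.
Qed.

(** * Edges monitored in the layered graphs *)

(** Every geodesic from [s] to [t] is level-monotone, so it crosses from the
    level of [x] to that of [y] exactly once; it remains to see that this
    crossing step is forced. *)
Lemma monitored_level (s t x y : layered) j : single j -> lev s <= j <= lev t ->
    lev s <= lev x -> lev y = (lev x).+1 -> lev y <= lev t ->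
    (forall x' y' : layered, adj x' y' -> lev x' = lev x -> lev y' = lev y ->
       d s x' = lev x - lev s -> d y' t = lev t - lev y -> x' = x /\ y' = y) ->
  monitored s t x y.
Proof.
move=> sj le_j sx yx yt U w gw.
have le_i : lev s <= lev x < lev t by lia.
have [x' [y' [x'x y'y dx dy [xy _ _ xyw]]]] :=
  graded_edge lev_adj gw (dist_single sj le_j) le_i.
by have [|||<- <-] := U x' y' xy x'x; rewrite ?yx.
Qed.

Lemma up_hub1 a b : a < N -> up hub.+1 a b -> a = if b < N then b else 0.
Proof. by case: ifP; level_lia. Qed.

Lemma lab_hub1 (x : layered) : lev x = hub.+1 -> lab x < N.
Proof. by move=> xi; have := slotP x; rewrite xi; level_lia. Qed.

Lemma lab_hub2 (x : layered) : lev x = hub.+2 -> lab x < N + q.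
Proof. by move=> xi; have := slotP x; rewrite xi; level_lia. Qed.

Lemma slot_hub1 a : a < N -> slot hub.+1 a.
Proof. by level_lia. Qed.

Lemma slot_hub2 a : a < N + q -> slot hub.+2 a.
Proof. by level_lia. Qed.

(** To the right of the hub a path from the left to level [hub.+2] has no
    choice: it passes through the hub, and its end determines the branch. *)
Lemma monitored_right (s x y : layered) : lev s <= hub -> adj x y ->
    lev y = (lev x).+1 -> hub <= lev x <= hub.+1 ->
  exists2 t, lev t = hub.+2 & monitored s t x y.
Proof.
move=> sH xy yx xH; have sh := single_hub.
have /orP[/eqP xh|/eqP xh] : (lev x == hub) || (lev x == hub.+1) by lia.
  have yh : lev y = hub.+1 by lia.
  have yN := lab_hub1 yh; have tS : slot hub.+2 (lab y) by apply: slot_hub2; lia.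
  exists (vtx hub.+2 (lab y)); first by rewrite lev_vtx.
  apply: (monitored_level (j := hub)); rewrite ?lev_vtx //; try lia.
  move=> x' y' x'y' x'x y'y _ dy; split; first by apply: single_eq; rewrite x'x ?xh.
  apply: vert_eq => //; have y'h : lev y' = hub.+1 by lia.
  have /adj_up_inv : adj y' (vtx hub.+2 (lab y)).
    by apply: (dist1_adj (Gc := Gc)); rewrite dy; lia.
  rewrite lev_vtx // lab_vtx // y'h => /(_ erefl)/(up_hub1 (lab_hub1 y'h)).
  by rewrite yN.
exists y; first by lia.
apply: (monitored_level (j := hub)) => //; try lia.
move=> x' y' x'y' x'x y'y _ dy; have E : y' = y by apply: (dist_eq0 (Gc := Gc)); lia.
split=> //; apply: vert_eq => //; rewrite E in x'y'.
move: (adj_up_inv x'y') (adj_up_inv xy); rewrite x'x -yx => /(_ erefl) h1 /(_ erefl) h2.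
have x'h : lev x' = hub.+1 by lia.
rewrite xh in h1 h2.
by rewrite (up_hub1 (lab_hub1 x'h) h1) (up_hub1 (lab_hub1 xh) h2).
Qed.

(** Two vertices of level [hub.+2] whose neighbours on level [hub.+1] differ have
    only the sink in common. Labels 0 and 1 are enough to find such a partner,
    because 1 is not in the clique. *)
Lemma monitored_end (x y : layered) : lev x = hub.+2 -> lev y = hub.+3 ->
  exists t, [/\ lev t = hub.+2, t != x & monitored x t x y].
Proof.
move=> xh yh; pose c := if lab x == 1 then 0 else 1.
have cN : c < N + q by rewrite /c; case: ifP; lia.
have sc := slot_hub2 cN.
have xy (z : layered) : lev z = hub.+2 -> adj z y.
  by move=> zh; apply: adj_up; rewrite ?zh ?yh // /up single_end orbT.
have cx : lab x != c by rewrite /c; case: ifP; lia.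
exists (vtx hub.+2 c); rewrite lev_vtx //; split=> //.
  by apply: contra_neq cx => <-; rewrite lab_vtx.
suff [] : monitored x (vtx hub.+2 c) x y /\
  monitored x (vtx hub.+2 c) y (vtx hub.+2 c) by [].
apply: (monitored_middle Gc); rewrite ?xy ?lev_vtx //.
- by apply: contra_neq cx => ->; rewrite lab_vtx.
- apply/negP=> /adj_cases; rewrite xh lev_vtx // lab_vtx // => -[[]|[]|[]]; try lia.
  by move: cx; rewrite /inclique /c; case: ifP; lia.
- by rewrite [adj _ _]adjv_sym; apply: xy; rewrite lev_vtx.
move=> z xz zt; case/adj_cases: (xz) => [[zE _]|[zE xz1]|[_ zE _ qx qz]].
- by apply: single_eq; rewrite zE xh ?single_end.
- have zh : lev z = hub.+1 by lia.
  move: (adj_up_inv zt); rewrite lev_vtx // lab_vtx // zh => /(_ erefl) zt1.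
  rewrite zh in xz1; have zN := lab_hub1 zh.
  have cN' : c < N by rewrite /c; case: ifP; lia.
  have := up_hub1 zN zt1; rewrite cN' (up_hub1 zN xz1) /c.
  by case: ifP => ?; case: ifP => ?; lia.
case/adj_cases: zt; rewrite lev_vtx // lab_vtx // zE.
- by case; lia.
- by case; lia.
by case=> _ _ _ _; move: qx; rewrite /inclique /c; case: ifP; lia.
Qed.

(** * Foldings and the vertices that they force *)

Definition relabel (g : nat -> nat -> nat) (x : layered) : layered :=
  vtx (lev x) (g (lev x) (lab x)).

Lemma relabel_hom g :
    (forall i a, slot i a -> slot i (g i a)) ->
    (forall i a b, slot i a -> slot i.+1 b -> up i a b ->
       up i (g i a) (g i.+1 b)) ->
    (forall a b, a < N + q -> b < N + q -> a != b -> inclique a -> inclique b ->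
       [/\ g hub.+2 a != g hub.+2 b, inclique (g hub.+2 a)
         & inclique (g hub.+2 b)]) ->
  graph_hom (relabel g).
Proof.
move=> gS gU gQ x y; have sx := gS _ _ (slotP x); have sy := gS _ _ (slotP y).
case/adj_cases=> [[yx xy]|[xy yx]|[xh yh xy xq yq]].
- apply: adj_up; rewrite ?lev_vtx // ?lab_vtx // yx; apply: gU; rewrite ?slotP //.
  by rewrite -yx slotP.
- rewrite [adj _ _]adjv_sym; apply: adj_up; rewrite ?lev_vtx // ?lab_vtx // xy.
  by apply: gU; rewrite ?slotP // -xy slotP.
have [gxy gx gy] := gQ _ _ (lab_hub2 xh) (lab_hub2 yh) xy xq yq.
rewrite xh in sx; rewrite yh in sy.
rewrite /relabel xh yh /adj /= /adjv !lev_vtx // !lab_vtx // /adjn.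
by rewrite gxy gx gy !eqxx orbT !orbT.
Qed.

Definition fold_side (T : pred nat) (c : nat) :=
  relabel (fun i a => if T i then c else a).

(** Within a cycle, [T] contains all the paired levels or none: where membership
    changes there is a singleton level, so relabelling does not break any
    edge. *)
Definition block (T : pred nat) :=
  (forall i, T i -> paired i) /\
  (forall i, T i != T i.+1 -> single i || single i.+1).

Lemma paired_hub2 : paired hub.+2 = false.
Proof. by level_lia. Qed.

Lemma slot_paired i a : paired i -> slot i a = (a < 2).
Proof. by move=> di; apply/idP/idP; move: di; level_lia. Qed.

Lemma fold_side_hom T c : block T -> c < 2 -> graph_hom (fold_side T c).
Proof.
move=> [Td Ts] c2; refine (relabel_hom _ _ _) => [i a|i a b _ _|a b _ _ ab qa qb].
- by case: ifP => // /Td di _; rewrite slot_paired.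
- have [TS|/Ts] := eqVneq (T i) (T i.+1); last first.
    by rewrite /up; case/orP=> ->; rewrite ?orbT.
  rewrite [up i a b]/up => /or4P[si|si|/eqP->|/and3P[/eqP i1 a0 bN]].
  - by rewrite /up si.
  - by rewrite /up si orbT.
  - by rewrite TS; case: ifP; rewrite /up eqxx !orbT.
  have -> : T i.+1 = false by apply/negP=> /Td; rewrite i1 paired_hub2.
  have -> : T i = false by rewrite TS; apply/negP=> /Td; rewrite i1 paired_hub2.
  by rewrite /up i1 eqxx a0 bN !orbT.
have -> : T hub.+2 = false by apply/negP=> /Td; rewrite paired_hub2.
by [].
Qed.

Lemma fold_side_id (T : pred nat) c (x : layered) :
  (T (lev x) -> lab x = c) -> fold_side T c x = x.
Proof.
move=> Tx; apply: esym; apply: vtx_eq => //; last by case: ifP => // /Tx.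
by case: ifP (slotP x) => // /Tx->.
Qed.

Lemma lev_fold_side T c (x : layered) : block T -> c < 2 ->
  lev (fold_side T c x) = lev x.
Proof.
move=> [Td _] c2; rewrite lev_vtx //; case: ifP (slotP x) => // /Td dx _.
by rewrite slot_paired.
Qed.

Lemma lab_fold_side T c (x : layered) : block T -> c < 2 ->
  lab (fold_side T c x) = if T (lev x) then c else lab x.
Proof.
move=> [Td _] c2; rewrite lab_vtx //; case: ifP (slotP x) => // /Td dx _.
by rewrite slot_paired.
Qed.

(** Folding the levels of [T] onto the side opposite to [c] moves exactly the
    vertices of side [c]. *)
Lemma meg_fold_side (S : {set layered}) (T : pred nat) i c :
    meg_set S -> block T -> T i -> c < 2 ->
  exists2 s, s \in S & T (lev s) /\ lab s = c.
Proof.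
move=> mS bT Ti c2; have [Td _] := bT; have di := Td _ Ti.
have [i0 ih] : 0 < i /\ i < hub by move: di => /andP[]; lia.
pose x : layered := vtx i c; have sx : slot i c by rewrite slot_paired.
have [|y yx _] := @lev_down x; first by rewrite lev_vtx.
have c1 : 1 - c < 2 by lia.
have [||s sS] := meg_moved layered_connected mS (fold_side_hom bT c1) (x := x) (y := y).
- by rewrite [adj _ _]adjv_sym.
- move=> z; apply/eqP=> zx; have := lab_fold_side z bT c1.
  have := lev_fold_side z bT c1; rewrite zx lev_vtx // lab_vtx // => <-.
  by rewrite Ti; lia.
move=> fs; exists s => //; have Ts : T (lev s).
  by apply: contraNT fs => Ns; rewrite fold_side_id // => /(negP Ns).
split=> //; have := slotP s; rewrite slot_paired ?Td // => s2.
suff: lab s != 1 - c by lia.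
by apply: contra fs => /eqP E; rewrite fold_side_id.
Qed.

Definition fold_branch (j j' : nat) :=
  relabel (fun i a => if (hub < i < hub.+3) && (a == j) then j' else a).

(** The branches that can be folded: all of them, except for branch 0 when
    clones hang on it. *)
Definition plain j := (j < N) && ((0 < j) || (q == 0)).

Lemma slot_branch i a j : hub < i < hub.+3 -> slot i a -> j < N -> slot i j.
Proof. by level_lia. Qed.

Lemma fold_branch_hom j j' : plain j -> j' < N -> graph_hom (fold_branch j j').
Proof.
move=> pj j'N; refine (relabel_hom _ _ _) => [i a ia|i a b _ ib|a b aN bN ab qa qb].
- by case: ifP => // /andP[hi _]; exact: slot_branch ia j'N.
- rewrite [up i a b]/up; case/or4P=> [si|si|/eqP<-|/and3P[/eqP i1 a0 bN]].
  + by rewrite /up si.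
  + by rewrite /up si orbT.
  + case: (eqVneq a j) => _; rewrite ?andbF ?andbT; last by rewrite /up eqxx !orbT.
    have [<-|NE] := eqVneq (hub < i < hub.+3) (hub < i.+1 < hub.+3).
      by rewrite /up eqxx !orbT.
    suff: single i || single i.+1 by rewrite /up; case/orP=> ->; rewrite ?orbT.
    move: NE; level_lia.
  have bj : (b == j) = false by move: pj; rewrite /plain; lia.
  rewrite bj andbF; have := pj; rewrite /plain; case/andP=> jN /orP[j0|q0].
    have -> : (a == j) = false by lia.
    by rewrite andbF /up i1 eqxx a0 bN !orbT.
  by have := slot_lt ib; move: ib; rewrite i1; move: q0 bN; level_lia.
rewrite ltnS ltnSn leqnSn /=.
have -> : (a == j) = false by move: pj qa qb; rewrite /plain /inclique; lia.
have -> : (b == j) = false by move: pj qa qb; rewrite /plain /inclique; lia.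
by split.
Qed.

Lemma meg_branch (S : {set layered}) j : meg_set S -> plain j ->
  exists2 s, s \in S & hub < lev s < hub.+3 /\ lab s = j.
Proof.
move=> mS pj; have jN : j < N by case/andP: pj.
pose j' := if j == 0 then 1 else 0.
have j'N : j' < N by rewrite /j'; case: ifP; lia.
have j'j : j' != j by rewrite /j'; case: ifP; lia.
have sx := slot_hub1 jN.
have [|y yx _] := @lev_down (vtx hub.+1 j); first by rewrite lev_vtx.
have sH := fold_branch_hom pj j'N.
have sS (z : layered) : slot (lev z)
    (if (hub < lev z < hub.+3) && (lab z == j) then j' else lab z).
  case: ifP => [/andP[hz _]|_]; last exact: slotP.
  exact: slot_branch hz (slotP z) j'N.
have [||s sS' fs] := meg_moved layered_connected mS sH (x := vtx hub.+1 j) (y := y).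
- by rewrite [adj _ _]adjv_sym.
- move=> z; apply/eqP=> zx; have : lev (fold_branch j j' z) = lev z by exact: lev_vtx.
  have : lab (fold_branch j j' z) =
    if (hub < lev z < hub.+3) && (lab z == j) then j' else lab z by exact: lab_vtx.
  rewrite zx lev_vtx // lab_vtx // => + zh; rewrite -zh.
  by rewrite ltnSn ltnS leqnSn /=; case: eqP; lia.
exists s => //; case: (boolP ((hub < lev s < hub.+3) && (lab s == j))).
  by case/andP=> ? /eqP.
move=> /negbTE E; case/eqP: fs; apply: esym; apply: vtx_eq; rewrite ?E //.
exact: slotP.
Qed.

(** Without the 6-cycle the source is a leaf, which folds onto level 2 (the
    branches, if [k] is 0). *)
Lemma meg_root (S : {set layered}) : meg_set S -> ~~ o -> source \in S.
Proof.
move=> mS o0.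
have s1 : single 1 by move: o0; rewrite /single /paired /hub; lia.
have s2 : slot 2 0 by apply: slot0; rewrite /hub; lia.
pose f (x : layered) : layered := if lev x == 0 then vtx 2 0 else x.
have nb0 (x y : layered) : adj x y -> lev x = 0 -> lev y = 1 /\ adj (vtx 2 0 : layered) y.
  move=> xy x0; have y1 : lev y = 1.
    by case/adj_cases: xy => [[]|[]|[]]; rewrite x0 // => ->.
  split=> //; rewrite [adj _ _]adjv_sym; apply: adj_up; rewrite ?lev_vtx ?y1 //.
  by rewrite /up s1.
have fh : graph_hom f.
  move=> x y xy; rewrite /f; case: eqP => [x0|_].
    by have [y1 ?] := nb0 x y xy x0; rewrite y1.
  case: eqP => // y0; rewrite [adj x y]adjv_sym in xy.
  by rewrite [adj _ _]adjv_sym; case: (nb0 y x xy y0).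
have [|y xy _] := @lev_up source; first by [].
have [|s sS] := meg_moved layered_connected mS fh xy.
  move=> z; apply/eqP; rewrite /f; case: eqP.
    by move=> _ /(congr1 (@lev)); rewrite lev_vtx.
  by move=> z0 /(congr1 (@lev)).
rewrite /f; case: ifP => [/eqP s0 _|]; last by rewrite eqxx.
by rewrite (@single_eq source s) ?single_root.
Qed.

(** Two vertices of the clique are adjacent twins, so moving one onto the other
    contracts their edge and moves nothing else. *)
Lemma clique_forced (S : {set layered}) a : edge_geodetic_set S -> 0 < q ->
  a < N + q -> inclique a -> vtx hub.+2 a \in S.
Proof.
move=> eS q0 aN qa; pose a' := if a == 0 then N else 0.
have a'N : a' < N + q by rewrite /a'; case: ifP; lia.
have qa' : inclique a' by rewrite /inclique /a'; case: ifP; lia.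
have Naa' : a != a' by rewrite /a'; case: ifP; lia.
pose x : layered := vtx hub.+2 a; pose x' : layered := vtx hub.+2 a'.
have [sx sx'] := (slot_hub2 aN, slot_hub2 a'N).
have cadj (b b' : nat) : slot hub.+2 b -> slot hub.+2 b' -> inclique b ->
    inclique b' -> b != b' -> adj (vtx hub.+2 b : layered) (vtx hub.+2 b').
  move=> sb sb' qb qb' bb'; rewrite /adj /= /adjv !lev_vtx // !lab_vtx // /adjn.
  by rewrite bb' qb qb' !eqxx !orbT.
have up0 c : inclique c -> c < N + q -> up hub.+1 0 c.
  by rewrite /inclique => /orP[/eqP->|Nc] _; rewrite /up ?Nc !eqxx !orbT.
have nb (y : layered) : adj x y -> x' = y \/ adj x' y.
  case/adj_cases=> [[]|[]|[]]; rewrite lev_vtx // lab_vtx //.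
  - move=> yh _; right; apply: adj_up; rewrite ?lev_vtx // lab_vtx // /up.
    by rewrite single_end orbT.
  - case=> /esym yh; rewrite yh => u_a; right; rewrite [adj _ _]adjv_sym.
    have yN := lab_hub1 yh; have y0 : lab y = 0.
      by rewrite (up_hub1 yN u_a); case: ifP => //; move: qa; rewrite /inclique; lia.
    by apply: adj_up; rewrite ?lev_vtx // ?lab_vtx // yh // y0; apply: up0.
  - move=> _ yh ay _ qy; have [a'y|Na'y] := eqVneq a' (lab y).
      by left; apply: vert_eq; rewrite ?lev_vtx ?lab_vtx // yh.
    right; have -> : y = vtx hub.+2 (lab y) by apply: vtx_eq => //; rewrite -yh slotP.
    by apply: cadj => //; rewrite -yh slotP.
pose f (y : layered) := if y == x then x' else y.
have fh : weak_hom f.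
  move=> y z yz; rewrite /f; case: eqP => [yx|_]; case: eqP => [zx|_]; auto.
  - by rewrite yx in yz; exact: nb.
  - rewrite zx [adj _ _]adjv_sym in yz; case: (nb y yz) => [->|x'y]; first by left.
    by right; rewrite [adj _ _]adjv_sym.
have [||s sS] := edge_geodetic_moved layered_connected eS fh (x := x) (y := x').
- exact: cadj.
- by rewrite /f eqxx; case: ifP => // /eqP ->.
by rewrite /f; case: ifP => [/eqP sE _|]; rewrite ?eqxx // -/x -sE.
Qed.

(** The part before the hub can be contracted to the hub, which is a cut
    vertex. *)
Lemma left_hit (S : {set layered}) : edge_geodetic_set S ->
  exists2 s, s \in S & lev s < hub.
Proof.
move=> eS; pose w : layered := vtx hub 0.
have lw : lev w = hub by rewrite lev_vtx // slot0 //; lia.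
pose f (x : layered) := if lev x < hub then w else x.
have fh : weak_hom f.
  move=> x y xy; rewrite /f; case: ltnP => xh; case: ltnP => yh; auto.
    left; apply: single_eq; rewrite lw ?single_hub //.
    by have := lev_adj xy; lia.
  left; apply: single_eq; rewrite ?lw; last suff -> : lev x = hub by exact: single_hub.
    by rewrite [adj _ _]adjv_sym in xy; have := lev_adj xy; lia.
  by rewrite [adj _ _]adjv_sym in xy; have := lev_adj xy; lia.
have [|y yw yh] := @lev_down w; first by rewrite lw /hub; lia.
have [|s sS] := edge_geodetic_moved layered_connected eS fh yw.
  by rewrite /f lw ltnn -{1}lw yh ltnSn.
by rewrite /f; case: ltnP => [h _|]; [exists s | rewrite eqxx].
Qed.

Lemma weak_hom_up (f : layered -> layered) :
    (forall x y : layered, adj x y -> lev y = (lev x).+1 ->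
       f x = f y \/ adj (f x) (f y)) ->
    (forall x y : layered, adj x y -> lev x = hub.+2 -> lev y = hub.+2 ->
       inclique (lab x) -> inclique (lab y) -> f x = f y \/ adj (f x) (f y)) ->
  weak_hom f.
Proof.
move=> fU fQ x y xy; case/adj_cases: (xy) => [[yx _]|[yx _]|[xh yh _ qx qy]].
- exact: fU.
- rewrite [adj x y]adjv_sym in xy; rewrite [adj _ _]adjv_sym.
  by case: (fU y x xy yx) => [->|]; [left | right].
- exact: fQ.
Qed.

(** The part after the hub can be folded onto the clique and the edge from the
    hub to a_0: the branches go to branch 0 and the sink goes to b_0, which
    contracts the edge between the sink and b_1. *)
Lemma right_hit (S : {set layered}) : edge_geodetic_set S ->
  exists2 s, s \in S & hub < lev s /\ ~~ ((lev s == hub.+2) && inclique (lab s)).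
Proof.
move=> eS; pose A0 : layered := vtx hub.+1 0; pose B0 : layered := vtx hub.+2 0.
have sA : slot hub.+1 0 by apply: slot_hub1; lia.
have sB : slot hub.+2 0 by apply: slot_hub2; lia.
pose f (x : layered) := if lev x <= hub then x else if lev x == hub.+1 then A0
  else if (lev x == hub.+2) && inclique (lab x) then x else B0.
have fE1 x : lev x <= hub -> f x = x by rewrite /f => ->.
have fE2 x : lev x = hub.+1 -> f x = A0.
  by move=> xh; rewrite /f xh ltnn eqxx.
have fE3 x : lev x = hub.+2 -> f x = if inclique (lab x) then x else B0.
  move=> xh; rewrite /f xh eqxx /=; have -> : (hub.+2 <= hub) = false by lia.
  by have -> : (hub.+2 == hub.+1) = false by lia.
have fE4 x : lev x = hub.+3 -> f x = B0.
  move=> xh; rewrite /f xh; have -> : (hub.+3 <= hub) = false by lia.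
  have -> : (hub.+3 == hub.+1) = false by lia.
  by have -> : (hub.+3 == hub.+2) = false by lia.
have fh : weak_hom f.
  apply: weak_hom_up => x y xy; last first.
    by move=> xh yh qx qy; rewrite !fE3 ?qx ?qy //; right.
  move=> yx; have := lev_le y; rewrite yx => le_x.
  have [lt_x|] := ltnP (lev x) hub; first by rewrite !fE1 ?yx; auto; lia.
  rewrite leq_eqVlt => /orP[/eqP/esym xh|].
    have yh : lev y = hub.+1 by lia.
    rewrite (fE1 x) ?xh // (fE2 y) //; right.
    by apply: adj_up; rewrite ?lev_vtx // xh // /up single_hub.
  rewrite leq_eqVlt => /orP[/eqP/esym xh|].
    have yh : lev y = hub.+2 by lia.
    rewrite (fE2 x) // (fE3 y) //; right.
    case: ifP => qy; apply: adj_up; rewrite ?lev_vtx ?lab_vtx ?yh //; last first.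
      by rewrite /up eqxx !orbT.
    by case/orP: qy => [/eqP->|Ny]; rewrite /up ?Ny !eqxx !orbT.
  move=> lt_x; have xh : lev x = hub.+2 by lia.
  have yh : lev y = hub.+3 by lia.
  rewrite (fE3 x) // (fE4 y) //; case: ifP => qx; last by left.
  have [x0|Nx0] := eqVneq (lab x) 0; first by left; exact: vtx_eq.
  right; rewrite /adj /= /adjv /adjn xh lev_vtx // lab_vtx // Nx0 qx !eqxx.
  by rewrite !orbT.
have s1 : slot hub.+2 1 by apply: slot_hub2; lia.
have xy : adj (vtx hub.+2 1 : layered) sink.
  by apply: adj_up; rewrite ?lev_end lev_vtx // /up single_end orbT.
have [|s sS] := edge_geodetic_moved layered_connected eS fh xy.
  rewrite fE3 ?lev_vtx // lab_vtx // (fE4 sink) ?lev_end // /inclique.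
  by case: ifP => //; lia.
rewrite /f; case: leqP => [|h fs]; first by rewrite eqxx.
exists s => //; split=> //; apply/negP=> E; move: fs; rewrite E.
have -> : (lev s == hub.+1) = false by lia.
by rewrite eqxx.
Qed.

(** * The geodetic and edge-geodetic numbers *)

Definition ends_and_clique : {set layered} :=
  [set x : layered | [|| x == source, x == sink |
     [&& lev x == hub.+2, inclique (lab x) & 0 < q]]].

Lemma eg_cover : edge_geodetic_set ends_and_clique.
Proof.
have rE : source \in ends_and_clique by rewrite inE eqxx.
have vE : sink \in ends_and_clique by rewrite inE eqxx orbT.
move=> x y xy; case/adj_cases: (xy) => [[yx _]|[yx _]|[xh yh xy' qx qy]].
- by have [w gw xyw] := ends_cover xy yx; exists source, sink, w; rewrite root_end.
- rewrite [adj x y]adjv_sym in xy; have [w gw xyw] := ends_cover xy yx.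
  by exists source, sink, w; rewrite root_end edge_onC.
have [w gw] := geodesic_ex Gc x y.
have q0 : 0 < q.
  move: (lab_hub2 xh) (lab_hub2 yh) qx qy xy'; rewrite /inclique; lia.
exists x, y, w; rewrite !inE xh yh qx qy q0 !eqxx !orbT; split=> //.
  by apply: contraNneq xy' => ->.
exact: (monitored_adj Gc xy).
Qed.

Definition eg_label (x : layered) : nat :=
  if lev x <= hub then 1 else
  if (lev x == hub.+2) && inclique (lab x) then
    if lab x == 0 then 2 else (lab x - N).+3
  else 0.

Lemma eg_card : #|ends_and_clique| <= if q == 0 then 2 else q.+3.
Proof.
have lu : eg_label source = 1 by [].
have lv : eg_label sink = 0.
  rewrite /eg_label lev_end; have -> : (hub.+3 <= hub) = false by lia.
  by have -> : (hub.+3 == hub.+2) = false by lia.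
have lq x : lev x = hub.+2 -> inclique (lab x) ->
    eg_label x = if lab x == 0 then 2 else (lab x - N).+3.
  move=> xh qx; rewrite /eg_label xh qx eqxx /=.
  by have -> : (hub.+2 <= hub) = false by lia.
apply: (card_le_labels (h := eg_label)) => [x|x y].
  rewrite inE => /or3P[/eqP->|/eqP->|/and3P[/eqP xh qx q0]].
  - by rewrite lu; case: ifP.
  - by rewrite lv; case: ifP.
  rewrite lq //; have := lab_hub2 xh; have -> : (q == 0) = false by lia.
  by case: ifP; lia.
rewrite !inE => /or3P[/eqP->|/eqP->|/and3P[/eqP xh qx q0]]
  /or3P[/eqP->|/eqP->|/and3P[/eqP yh qy _]]; rewrite ?lu ?lv ?(lq x) ?(lq y) //;
  try by case: ifP.
move=> E; apply: vert_eq; rewrite ?xh ?yh //.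
move: qx qy E; rewrite /inclique; case: ifP; case: ifP; lia.
Qed.

Theorem eg_number : edge_geodetic_number_is layered (if q == 0 then 2 else q.+3).
Proof.
have lb (S : {set layered}) : edge_geodetic_set S -> (if q == 0 then 2 else q.+3) <= #|S|.
  have [|y xy _] := @lev_up source; first by [].
  move=> eS; have [_|q0] := eqVneq q 0; first exact: edge_geodetic_gt1 xy eS.
  apply: (card_ge_labels (h := eg_label)) => c c_lt.
  have [c0|c_gt0] := posnP c.
    have [s sS [sh Ns]] := right_hit eS; exists s => //.
    by rewrite /eg_label leqNgt sh (negbTE Ns) c0.
  have [c1|c_gt1] := eqVneq c 1.
    have [s sS sh] := left_hit eS; exists s => //.
    by rewrite /eg_label (ltnW sh) c1.
  pose a := if c == 2 then 0 else N + (c - 3).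
  have aN : a < N + q by rewrite /a; case: ifP; lia.
  have qa : inclique a by rewrite /a /inclique; case: ifP; lia.
  exists (vtx hub.+2 a); first by apply: clique_forced => //; lia.
  rewrite /eg_label lev_vtx ?lab_vtx ?slot_hub2 // qa eqxx /=.
  have -> : (hub.+2 <= hub) = false by lia.
  by rewrite /a; case: (eqVneq c 2) => [->//|c2]; case: ifP; lia.
split=> //; exists ends_and_clique; first exact: eg_cover.
by apply/eqP; rewrite eqn_leq eg_card lb //; exact: eg_cover.
Qed.

Theorem g_number : geodetic_number_is layered 2.
Proof.
split=> [|S /(_ source)[u [v [w [uS vS uv _ _]]]]]; last by apply/card_gt1P; exists u, v.
by exists [set source; sink]; [exact: geodetic_ends | rewrite cards2 root_end].
Qed.

(** * The strong edge-geodetic number *)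

(** A geodesic that crosses the branch from a_j to b_j comes from the hub and
    goes on to the sink, so it has length at least 3. From a vertex beyond the
    hub the sink is at distance at most 2, and from the hub all vertices beyond
    it except for the sink are at distance at most 2, so such a geodesic starts
    before or at the hub and ends at the sink. *)
Lemma crossing_ends (s t : layered) j : plain j ->
    let a : layered := vtx hub.+1 j in let b : layered := vtx hub.+2 j in
    d s t = d s a + 1 + d b t -> s != a -> t != b ->
  lev s <= hub /\ t = sink.
Proof.
move=> pj a b dE sa tb; have jN : j < N by case/andP: pj.
have slA := slot_hub1 jN; have slB : slot hub.+2 j by apply: slot_hub2; lia.
pose w : layered := vtx hub 0; have lw : lev w = hub by rewrite lev_vtx // slot0 //; lia.
have [z za sz] : exists2 z, adj z a & d s a = (d s z).+1.
  by apply: dist_pred; rewrite eq_sym.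
have zE : z = w.
  case/adj_cases: za (za); rewrite lev_vtx // lab_vtx //.
  - by case=> -[zh] _ _; apply: single_eq; rewrite -zh ?single_hub // lw.
  - case=> zh u_jz _; have zb : z = b.
      apply: vtx_eq => //; move: (lab_hub2 zh) pj (up_hub1 jN u_jz); rewrite /plain.
      by case: ifP; lia.
    by have := dist_tri Gc b s t; move: sz; rewrite zb; lia.
  - by case; lia.
have [y yb ty] : exists2 y, adj y b & d t b = (d t y).+1.
  by apply: dist_pred; rewrite eq_sym.
have yE : y = sink.
  case/adj_cases: yb (yb); rewrite lev_vtx // lab_vtx //.
  - case=> -[yh]; rewrite -yh => u_yj _; have ya : y = a.
      apply: vtx_eq => //; move: (lab_hub1 (esym yh)) (u_yj) => yN /(up_hub1 yN).
      by rewrite jN.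
    have := dist_tri Gc a s t; have := dist_sym Gc a t; have := dist_sym Gc b t.
    by move: ty; rewrite ya; lia.
  - by case=> yh _ _; apply: single_eq; rewrite yh ?single_end // lev_end.
  - case=> yh _ Nyj qy qj _; move: (lab_hub2 yh) pj Nyj qy qj.
    by rewrite /plain /inclique; lia.
have stE : d s t = d s w + 3 + d sink t.
  have := dist_sym Gc b t; have := dist_sym Gc t y.
  by move: sz ty; rewrite zE yE; lia.
have s_hub : lev s <= hub.
  rewrite leqNgt; apply/negP=> lt_s; have := dist_end s.
  by have := dist_tri Gc sink s t; lia.
split=> //; suff tE : hub.+3 <= lev t.
  have th : lev t = hub.+3 by have := lev_le t; lia.
  by apply: single_eq; rewrite th ?lev_end ?single_end.
have := dist_tri Gc w s t; have := dist_end t; have := dist_sym Gc sink t.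
have [le_t|lt_t] := leqP (lev t) hub.
  have := @dist_single t w hub single_hub; rewrite lw le_t leqnn => /(_ isT).
  by have := dist_sym Gc w t; lia.
have := @dist_single w t hub single_hub; rewrite lw leqnn ltnW // => /(_ isT).
by lia.
Qed.

(** The position at which a path to the sink meets level [hub.+1] is fixed, hence
    such a path crosses at most one branch. *)
Lemma crossing_nth (s : layered) w j : lev s <= hub -> j < N ->
  geodesic s sink w -> edge_on (vtx hub.+1 j : layered) (vtx hub.+2 j) w ->
  nth s w (hub.+1 - lev s) = vtx hub.+1 j.
Proof.
move=> sh jN gw /edge_on_mem[aw _].
have := @dist_single s (vtx hub.+1 j) hub single_hub.
rewrite lev_vtx ?slot_hub1 // sh leqnSn => /(_ isT) E.
have -> : hub.+1 - lev s = d s (vtx hub.+1 j) by lia.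
exact: geodesic_at gw aw.
Qed.

(** Labels below [N + q] are attained as follows: the clique is forced; a branch
    containing a chosen vertex is labelled by it; any other branch is crossed by
    the path to the sink from a chosen vertex on the left, which receives the
    number of that unique branch. The label [N + q] is that of the sink if it is
    chosen, and otherwise that of any chosen vertex on the left. *)
Lemma seg_lower (S : {set layered}) : strong_edge_geodetic_set S -> N + q < #|S|.
Proof.
move=> sS; have eS := strong_edge_geodetic_weak sS; case: sS => P [gP eP].
pose crossed (s : layered) (j : 'I_N) :=
  edge_on (vtx hub.+1 j : layered) (vtx hub.+2 j) (P s sink).
pose h (s : layered) : nat :=
  if lev s <= hub then
    if sink \in S then if [pick j | crossed s j] is Some j then nat_of_ord j else N + q
    else N + q
  else if s == sink then N + q else lab s.
have hR s : hub < lev s < hub.+3 -> h s = lab s.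
  move=> hs; rewrite /h; have -> : (lev s <= hub) = false by lia.
  by case: eqP => // sv; move: hs; rewrite sv lev_end; lia.
apply: (card_ge_labels (h := h)) => c; rewrite ltnS leq_eqVlt => /orP[/eqP->|cN].
  have [vS|NvS] := boolP (sink \in S).
    exists sink => //; rewrite /h lev_end eqxx.
    by have -> : (hub.+3 <= hub) = false by lia.
  by have [s sS sh] := left_hit eS; exists s; rewrite // /h (ltnW sh) (negbTE NvS).
have sc := slot_hub2 cN; have [qc|Nqc] := boolP (inclique c && (0 < q)).
  case/andP: qc => qc q0; exists (vtx hub.+2 c); first exact: clique_forced.
  by rewrite hR ?lev_vtx ?lab_vtx //; lia.
have pc : plain c by move: Nqc; rewrite /plain /inclique; lia.
have cN' : c < N by case/andP: pc.
have sc1 := slot_hub1 cN'.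
pose a : layered := vtx hub.+1 c; pose b : layered := vtx hub.+2 c.
have [aS|NaS] := boolP (a \in S).
  by exists a => //; rewrite hR ?lev_vtx ?lab_vtx //; lia.
have [bS|NbS] := boolP (b \in S).
  by exists b => //; rewrite hR ?lev_vtx ?lab_vtx //; lia.
have ab : adj a b by apply: adj_up; rewrite ?lev_vtx ?lab_vtx // /up eqxx !orbT.
have NS s (sS : s \in S) : s != a /\ s != b.
  by split; [apply: contraNneq NaS | apply: contraNneq NbS] => <-.
have [s [sS sh vS Nsv cr]] : exists s,
    [/\ s \in S, lev s <= hub, sink \in S, s != sink & crossed s (Ordinal cN')].
  have [s [t [sS tS st abP]]] := eP a b ab.
  have [gst Pts] := gP s t sS tS st.
  have [[sa sb] [ta tb]] := (NS s sS, NS t tS).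
  case: (geodesic_edge Gc gst abP) => dE.
    have [sh tv] := crossing_ends pc dE sa tb.
    by exists s; rewrite /crossed -tv.
  have dE' := dist_through_sym dE.
  have [th sv] := crossing_ends pc dE' ta sb.
  by exists t; rewrite /crossed -sv Pts edge_on_rev eq_sym.
exists s => //; rewrite /h sh vS.
case: pickP => [j crj|/(_ (Ordinal cN'))]; last by rewrite cr.
have [gs _] := gP _ _ sS vS Nsv.
have := crossing_nth sh (ltn_ord j) gs crj.
rewrite (crossing_nth sh cN' gs cr) => /(congr1 (@lab)).
by rewrite !lab_vtx ?slot_hub1.
Qed.

Definition root_and_tips : {set layered} :=
  [set x : layered | (x == source) || (lev x == hub.+2)].

Lemma seg_card : #|root_and_tips| <= (N + q).+1.
Proof.
pose h (x : layered) := if lev x == hub.+2 then lab x else N + q.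
apply: (card_le_labels (h := h)); rewrite /h.
  by move=> x _; case: eqP => [/lab_hub2|]; lia.
have u0h : lev source == hub.+2 = false by [].
move=> x y; rewrite !inE => /orP[/eqP->|xh] /orP[/eqP->|yh] //; rewrite ?u0h ?xh ?yh.
- by have := lab_hub2 (eqP yh); lia.
- by have := lab_hub2 (eqP xh); lia.
by apply: vert_eq; rewrite (eqP xh) (eqP yh).
Qed.

Lemma block_paired : block paired.
Proof. by split=> // i; level_lia. Qed.

(** Right of the hub any choice of geodesics covers. On the left, the geodesic
    from the source to b_c is folded onto side [c] of all cycles, for c = 0
    and 1; a folded geodesic contains all the edges of that side, since it meets
    every level. *)
Lemma seg_cover : strong_edge_geodetic_set root_and_tips.
Proof.
pose S := root_and_tips; have [R gR] := geodesic_choice Gc.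
pose side (x y : layered) : nat := (lab x == 1) || (lab y == 1).
(* Folding onto side 1 exactly when an end is b_1; the source has label 0. *)
pose Q x y := map (fold_side paired (side x y)) (R x y).
pose before (x y : layered) :=
  (lev x < lev y) || (lev x == lev y) && (lab x < lab y).
have side2 x y : side x y < 2 by rewrite /side; case: (_ || _).
have idS c x : x \in S -> fold_side paired c x = x.
  rewrite !inE => /orP[/eqP->|/eqP xh]; apply: fold_side_id => //.
  by rewrite xh paired_hub2.
have gQ x y : x \in S -> y \in S -> geodesic x y (Q x y).
  move=> xS yS; apply: (geodesic_map Gc) => //; [|exact: idS|exact: idS].
  exact: fold_side_hom block_paired (side2 _ _).
have uS : source \in S by rewrite inE eqxx.
have hS (x : layered) : lev x = hub.+2 -> x \in S by move=> xh; rewrite inE xh eqxx orbT.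
have Nu0 (x : layered) : lev x = hub.+2 -> source != x.
  by move=> xh; apply/eqP=> /(congr1 (@lev)); rewrite xh.
have mon x y s t : s \in S -> t \in S -> s != t -> monitored s t x y ->
    exists u v, [/\ u \in S, v \in S, u != v, before u v & edge_on x y (Q u v)].
  move=> sS tS st m; have [bst|bts] : before s t \/ before t s.
    apply/orP; apply: contraR st; rewrite /before => E; apply/eqP.
    by apply: vert_eq; lia.
  - by exists s, t; split=> //; apply: m; exact: gQ.
  by exists t, s; rewrite eq_sym; split=> //; apply/monitored_sym: (gQ t s tS sS).
have cover (x y : layered) : adj x y -> lev y = (lev x).+1 ->
    exists u v, [/\ u \in S, v \in S, u != v, before u v & edge_on x y (Q u v)].
  move=> xy yx; have := lev_le y; rewrite yx => le_x.
  have [lt_x|le_hx] := ltnP (lev x) hub; last first.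
    have [le_x'|lt_x'] := leqP (lev x) hub.+1.
      have [//||t th m] := @monitored_right source x y _ xy yx; first by rewrite le_hx.
      by apply: (mon x y source t) => //; [exact: hS | exact: Nu0].
    have xh : lev x = hub.+2 by lia.
    have [|t [th tx m]] := @monitored_end x y xh; first by lia.
    by apply: (mon x y x t); rewrite ?hS // eq_sym.
  (* The side of the edge; 0 if both levels are singletons. *)
  pose c := if paired (lev x) then lab x else lab y.
  have c2 : c < 2.
    rewrite /c; case: ifP => [dx|_]; first by rewrite -(slot_paired _ dx) slotP.
    case: (boolP (paired (lev y))) => [dy|]; first by rewrite -(slot_paired _ dy) slotP.
    move=> Ndy; have := slotP y; rewrite /slot (negbTE Ndy); lia.
  have cS : slot hub.+2 c by apply: slot_hub2; lia.
  pose t : layered := vtx hub.+2 c; have th : lev t = hub.+2 by rewrite lev_vtx.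
  exists source, t; rewrite uS hS // Nu0 //; split=> //; first by rewrite /before th.
  have sE : side source t = c by rewrite /side lab_vtx //=; move: (c) c2 => [|[|]].
  have gut : geodesic source t (Q source t) by apply: gQ => //; exact: hS.
  have lt_i : lev source <= lev x < lev t.
    by rewrite th (_ : lev source = 0) //; lia.
  have dut := @dist_single source t 0 single_root isT.
  have [x' [y' [x'x y'y _ _ [_ x'Q y'Q]]]] := graded_edge lev_adj gut dut lt_i.
  have labE (z : layered) : z \in Q source t -> paired (lev z) -> lab z = c.
    rewrite /Q sE => /mapP[z' _ ->].
    by rewrite (lev_fold_side _ block_paired c2) (lab_fold_side _ block_paired c2) => ->.
  have near_single i : i <= hub -> ~~ paired i -> single i.
    by rewrite /single; lia.
  have -> : x' = x.
    have [dx|Ndx] := boolP (paired (lev x)).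
      by apply: vert_eq => //; rewrite labE ?x'x // /c dx.
    by apply: single_eq => //; rewrite x'x near_single //; lia.
  have -> // : y' = y.
  rewrite -yx in y'y; have [dy|Ndy] := boolP (paired (lev y)).
    apply: vert_eq => //; rewrite labE ?y'y // /c; case: ifP => // dx.
    have := adj_up_inv xy yx; rewrite /up -yx.
    by move: dx dy; rewrite /single => -> ->; move: lt_x; lia.
  by apply: single_eq => //; rewrite y'y near_single //; lia.
apply: (strong_edge_geodeticI (before := before) (Q := Q)) => [x y xy|//|x y xy].
  rewrite /before; have [E|] := eqVneq (lev x) (lev y); last by lia.
  suff : lab x != lab y by lia.
  by apply: contraNneq xy => E'; apply/eqP; apply: vert_eq.
case/adj_cases: (xy) => [[yx _]|[yx _]|[xh yh Nxy _ _]].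
- exact: cover.
- rewrite [adj x y]adjv_sym in xy; have [u [v [? ? ? ? e]]] := cover y x xy yx.
  by exists u, v; rewrite edge_onC.
apply: (mon x y x y); rewrite ?hS //; first by apply: contraNneq Nxy => ->.
exact: (monitored_adj Gc).
Qed.

Theorem seg_number : strong_edge_geodetic_number_is layered (N + q).+1.
Proof.
split=> [|S]; last exact: seg_lower.
exists root_and_tips; first exact: seg_cover.
by apply/eqP; rewrite eqn_leq seg_card seg_lower //; exact: seg_cover.
Qed.

(** * The monitoring edge-geodetic number *)

(** The levels before the hub that are chosen entirely: the even ones, except
    that in the 6-cycle the neighbours of the source replace levels 0 and 2. *)
Definition kept i := (i < hub) && (if o && (i < 3) then i == 1 else ~~ odd i).

Definition kept_and_tips : {set layered} :=
  [set x : layered | (lev x == hub.+2) || kept (lev x)].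

(** Beyond the hub, the labels of the vertices number the branches and the
    clones from 0 to [N + q - 1]. Before it, the numbers from [N + q] on go to
    the source if it is a leaf and to the sides of the cycles, two for each
    cycle. Truncated subtraction gives the same number to levels 1 and 2 of one
    side of the 6-cycle, where either vertex serves to hit that side. *)
Definition meg_label (x : layered) : nat :=
  if hub < lev x then lab x else N + q + (lev x - o.+1) + lab x.

Lemma slot_left i a : i <= hub -> slot i a -> a <= paired i.
Proof. by move=> ih; rewrite /slot; case: (paired i) => //=; lia. Qed.

Lemma kept_cases i a : kept i -> slot i a -> a < 2 /\
  (if o then i = 1 \/ 4 <= i /\ ~~ odd i
   else i = 0 /\ a = 0 \/ 2 <= i /\ ~~ odd i).
Proof.
move=> /andP[ih ki] ia; have := slot_left (ltnW ih) ia.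
move: ki; rewrite /paired; case: (o) => /=; last first.
  case: i {ia} ih => [|[|i]] //= ih; first by rewrite leqn0 => _ /eqP->; auto.
  by move=> Ni /leq_trans le_a; split; [apply: le_a; case: (_ && _) | auto].
case: ltnP => i3 Hi le_a; split.
- by apply: leq_trans le_a _; case: (_ && _).
- by left; apply/eqP.
- by apply: leq_trans le_a _; case: (_ && _).
right; split=> //; move: Hi i3; clear; case: i => [|[|[|[|i]]]] //.
Qed.

Lemma kept_bound i : kept i -> i < k.*2 + o.*2 + 1.
Proof. by case/andP. Qed.

Lemma meg_card : #|kept_and_tips| <= N + q + k.*2 + o.+1.
Proof.
apply: (card_le_labels (h := meg_label)) => [x|x y]; rewrite !inE /meg_label.
  case/orP=> [/eqP xh|kx]; first by have := lab_hub2 xh; rewrite xh; case: ifP; lia.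
  have xh : lev x < hub by case/andP: kx.
  have -> : (hub < lev x) = false by lia.
  have [a2] := kept_cases kx (slotP x); have := kept_bound kx.
  by case: (o) => /=; lia.
move=> xM yM; have cases z : (lev z == hub.+2) || kept (lev z) ->
    (hub < lev z) = (lev z == hub.+2).
  by case/orP=> [/eqP->|/andP[zh _]]; lia.
rewrite (cases x xM) (cases y yM).
case: (eqVneq (lev x) hub.+2) xM => [xh _|Nx /= kx];
  case: (eqVneq (lev y) hub.+2) yM => [yh _|Ny /= ky].
- by move=> E; apply: vert_eq; rewrite ?xh ?yh.
- by have := lab_hub2 xh; lia.
- by have := lab_hub2 yh; lia.
have [a2 Ex] := kept_cases kx (slotP x); have [b2 Ey] := kept_cases ky (slotP y).
move=> E; have E' : lev x - o.+1 + lab x = lev y - o.+1 + lab y by lia.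
have xy : lev x = lev y by move: Ex Ey a2 b2 E'; clear; case: (o) => /=; lia.
by apply: vert_eq => //; move: E'; rewrite xy; lia.
Qed.

Lemma meg_lower (S : {set layered}) : meg_set S -> N + q + k.*2 + o.+1 <= #|S|.
Proof.
move=> mS; have eS := meg_edge_geodetic layered_connected mS.
apply: (card_ge_labels (h := meg_label)) => c c_lt.
have [cN|Nc] := ltnP c (N + q).
  have sc := slot_hub2 cN; have [qc|Nqc] := boolP (inclique c && (0 < q)).
    case/andP: qc => qc q0; exists (vtx hub.+2 c); first exact: clique_forced.
    by rewrite /meg_label lev_vtx ?lab_vtx // ltnS leqnSn.
  have pc : plain c by move: Nqc; rewrite /plain /inclique; lia.
  have [s sS [/andP[hs _] sc']] := meg_branch mS pc.
  by exists s; rewrite // /meg_label hs.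
pose e := c - (N + q); have cE : c = N + q + e by rewrite /e; lia.
have le_e : e < k.*2 + o.+1 by lia.
have fromT (T : pred nat) b : block T -> (exists i, T i) -> b < 2 ->
    (forall i, T i -> i - o.+1 + b = e) -> exists2 s, s \in S & meg_label s = c.
  move=> bT [i Ti] b2 Te; have [s sS [Ts sb]] := meg_fold_side mS bT Ti b2.
  have [Td _] := bT; have /andP[/andP[_ sh] _] := Td _ Ts.
  exists s => //; rewrite /meg_label; have -> : (hub < lev s) = false by lia.
  by rewrite sb cE -(Te _ Ts); lia.
(* The first o + 1 labels belong to the leaf or to the 6-cycle, and the others
   to the 4-cycles. *)
have [lt_e|ge_e] := ltnP e o.+1.
  have [oT|oF] := boolP o; last first.
    exists source; first exact: meg_root.
    have e0 : e = 0 by move: lt_e; rewrite (negbTE oF); lia.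
    have [l0 a0] : lev source = 0 /\ lab source = 0 by [].
    by rewrite /meg_label l0 a0 ltn0 cE e0 sub0n !addn0.
  apply: (fromT [pred i | (i == 1) || (i == 2)] e).
  - by split=> i /=; rewrite /single /paired /hub oT /=; lia.
  - by exists 1.
  - by move: lt_e; rewrite oT.
  - by move=> i /=; rewrite oT; lia.
(* The level and the side of the 4-cycle vertex that is numbered e. *)
pose i := (e - o.+1)./2.*2 + 2 + o.*2.
apply: (fromT (pred1 i) (odd (e - o.+1) : nat)).
- by split=> j /=; rewrite /single /paired /hub /i; move: ge_e le_e; case: o => //=; lia.
- by exists i => /=.
- by case: odd.
by move=> j /= /eqP->; rewrite /i; move: ge_e; case: o => //=; lia.
Qed.

Lemma kept_next i : kept i -> single i.+1 || ~~ single i.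
Proof.
rewrite /kept /single /paired => /andP[ih].
have [hO] := hubP; case: (o) => /= h1; last by lia.
by case: ifP => [_ /eqP iE|i3]; [rewrite iE in ih * |]; lia.
Qed.

Lemma kept_odd i : i < hub -> ~~ kept i ->
  [/\ kept i.+1, single i & o <= i] \/ o /\ (i = 0 \/ i = 2).
Proof.
rewrite /kept /single /paired => ih; rewrite ih /=.
have [hO h1] := hubP; case: (o) h1 => /= h1; last by left; split; lia.
case: ifP => i3 Hi; first by right; split=> //; lia.
by left; case: ifP; split; lia.
Qed.

Lemma same_lab (x y : layered) : adj x y -> lev y = (lev x).+1 ->
  ~~ single (lev x) -> ~~ single (lev y) -> lev x < hub -> lab x = lab y.
Proof.
move=> xy yx Nx Ny lt_x; have := adj_up_inv xy yx.
rewrite /up -yx (negbTE Nx) (negbTE Ny) /= => /orP[/eqP->//|/and3P[/eqP xh _ _]].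
by rewrite xh ltnNge leqnSn in lt_x.
Qed.

(** A path from a chosen vertex [x] to level [hub.+2] has its first step forced,
    because the next level is a singleton or is matched with that of [x]. *)
Lemma monitored_kept (x y t : layered) : kept (lev x) -> adj x y ->
  lev y = (lev x).+1 -> lev t = hub.+2 -> monitored x t x y.
Proof.
move=> kx xy yx th; have sH := single_hub; have /andP[lt_x _] := kx.
apply: (monitored_level sH) => //.
- by rewrite th (ltnW lt_x) leqW.
- by rewrite yx th ltnW // ltnS ltnW.
move=> x' y' x'y' x'x y'y dx _.
have x'E : x' = x by apply/esym/(@dist_eq0 _ Gc); rewrite dx subnn.
split=> //; have [sy|Ny] := boolP (single (lev y)).
  by apply: single_eq; rewrite ?y'y.
have Nx : ~~ single (lev x) by have := kept_next kx; rewrite -yx (negbTE Ny).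
rewrite x'E in x'y'; apply: vert_eq => //.
by rewrite -(same_lab xy) // -(same_lab x'y') // y'y.
Qed.

Lemma monitored_from (r x y : layered) : lev r <= lev x -> single (lev x) ->
  lev y = (lev x).+1 -> monitored r y x y.
Proof.
move=> rx sx yx; apply: (monitored_level sx) => //; rewrite ?yx ?rx ?leqnSn //.
move=> x' y' _ x'x _ _ dy; split; first by apply: single_eq; rewrite x'x.
by apply: (@dist_eq0 _ Gc); rewrite dy subnn.
Qed.

Lemma odd_levels : o -> [/\ kept 1, paired 1, paired 2, single 3 & 2 < hub].
Proof. by rewrite /kept /single /paired /hub => -> /=; split; lia. Qed.

Lemma lab_paired (x : layered) i : lev x = i -> paired i -> lab x < 2.
Proof. by move=> xi di; rewrite -(slot_paired _ di) -xi slotP. Qed.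

Lemma paired_single i : paired i -> ~~ single i.
Proof. by rewrite /single => ->. Qed.

(** The edges of the 6-cycle at the source: the two neighbours of the source have
    no other common neighbour. *)
Lemma monitored_first (x y : layered) : o -> lev x = 0 -> lev y = 1 ->
  exists z : layered, [/\ lev z = 1, z != y & monitored z y x y].
Proof.
move=> oT x0 y1; have [_ d1 d2 _ h2] := odd_levels oT.
have y2 := lab_paired y1 d1; have s0 := single_root.
pose z : layered := vtx 1 (1 - lab y).
have sz : slot 1 (1 - lab y) by rewrite slot_paired // ltnS leq_subr.
have lz : lev z = 1 by rewrite lev_vtx.
have zy : lab z != lab y by rewrite lab_vtx //; case: (lab y) y2 => [|[]].
have adj0 (v : layered) : lev v = 1 -> adj x v.
  by move=> v1; apply: adj_up; rewrite x0 // /up s0.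
exists z; split=> //; first by apply: contraNneq zy => ->.
suff [] : monitored z y z x /\ monitored z y x y by [].
apply: (monitored_middle Gc); rewrite ?adj0 //.
- by apply: contraNneq zy => ->.
- apply/negP=> /adj_cases; rewrite lz y1; case=> [[//]|[//]|[/eqP //]].
- by rewrite [adj _ _]adjv_sym; apply: adj0.
move=> v zv vy; have [v_0|/eqP Nv0] := eqVneq (lev v) 0.
  by apply: single_eq; rewrite v_0 ?x0.
case/adj_cases: (zv) => [[+ _]|[+ _]|[+ _ _ _ _]]; rewrite lz;
  [move=> v2 | by case=> /esym/Nv0 | by move/eqP].
have dv : ~~ single (lev v) by rewrite v2 paired_single.
have N1 := paired_single d1.
rewrite [adj v y]adjv_sym in vy; case/eqP: zy.
by rewrite (same_lab zv) ?(same_lab vy) ?lz ?y1 // (leq_trans _ h2).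
Qed.

(** The far edges of the 6-cycle, monitored from level 1 because a path from
    there stays on its side up to level 3. *)
Lemma monitored_second (x y t : layered) : o -> lev x = 2 -> lev y = 3 ->
    lev t = hub.+2 ->
  exists z : layered, lev z = 1 /\ monitored z t x y.
Proof.
move=> oT x2 y3 th; have [_ d1 d2 s3 h2] := odd_levels oT.
have [N1 N2] := (paired_single d1, paired_single d2).
have sz : slot 1 (lab x) by rewrite slot_paired // (lab_paired x2).
pose z : layered := vtx 1 (lab x); have lz : lev z = 1 by rewrite lev_vtx.
exists z; split=> //; apply: (monitored_level single_hub).
- by rewrite lz th (leq_trans _ h2) // ltnW.
- by rewrite lz x2.
- by rewrite y3 x2.
- by rewrite y3 th; do 2?apply: leqW.
move=> x' y' _ x'x y'y dzx _; split; last by apply: single_eq; rewrite y'y ?y3.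
have zx' : adj z x' by apply: (dist1_adj (Gc := Gc)); rewrite dzx x2 lz.
apply: vert_eq => //.
by rewrite -(same_lab zx') ?lab_vtx ?lz ?x'x ?x2 // (leq_trans _ h2).
Qed.

Lemma kept_base : kept o.
Proof. by rewrite /kept /hub; case: (o) => //=; lia. Qed.

Lemma lt_hub2 i : i < hub -> i < hub.+2.
Proof. by move=> ih; do 2!apply: leqW. Qed.

Lemma meg_cover_up (x y : layered) : adj x y -> lev y = (lev x).+1 ->
  exists s t, [/\ s \in kept_and_tips, t \in kept_and_tips, s != t
                 & monitored s t x y].
Proof.
have hM (z : layered) : lev z = hub.+2 -> z \in kept_and_tips.
  by move=> zh; rewrite inE zh eqxx.
have kM (z : layered) : kept (lev z) -> z \in kept_and_tips.
  by move=> kz; rewrite inE kz orbT.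
have ko := kept_base; have /andP[oh _] := ko.
have so : slot o 0 by apply: slot0; rewrite leqW // ltnW // lt_hub2.
have sb : slot hub.+2 0 by apply: slot0.
pose b0 : layered := vtx hub.+2 0; have lb : lev b0 = hub.+2 by rewrite lev_vtx.
pose r : layered := vtx o 0; have lr : lev r = o by rewrite lev_vtx.
have rM : r \in kept_and_tips by apply: kM; rewrite lr.
have lvN (z t : layered) : lev z < lev t -> z != t.
  by apply: contraTneq => ->; rewrite ltnn.
move=> xy yx; have := lev_le y; rewrite yx ltnS => le_x.
have [lt_x|le_hx] := ltnP (lev x) hub; last first.
  have [le_x'|lt_x'] := leqP (lev x) hub.+1.
    have [||t th m] := @monitored_right r x y _ xy yx; first by rewrite lr ltnW.
      by rewrite le_hx.
    exists r, t; split=> //; first exact: hM.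
    by apply: lvN; rewrite th lr lt_hub2.
  have xh : lev x = hub.+2 by apply/eqP; rewrite eqn_leq le_x.
  have [|t [th tx m]] := @monitored_end x y xh; first by rewrite yx xh.
  by exists x, t; rewrite !hM // eq_sym.
have [kx|Nkx] := boolP (kept (lev x)).
  exists x, b0; split; [exact: kM | exact: hM | | exact: monitored_kept].
  by apply: lvN; rewrite lb lt_hub2.
case: (kept_odd lt_x Nkx) => [[ky sx ox]|[oT x02]].
  exists r, y; split=> //; first by apply: kM; rewrite yx.
    by apply: lvN; rewrite lr yx.
  by apply: monitored_from; rewrite ?lr.
have [k1 _ _ _ h2] := odd_levels oT.
case: x02 => x02; rewrite x02 in yx.
  have [z [z1 zy m]] := monitored_first oT x02 yx.
  by exists z, y; rewrite !kM ?z1 ?yx.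
have [z [z1 m]] := monitored_second oT x02 yx lb.
exists z, b0; rewrite kM ?z1 // hM //; split=> //.
by apply: lvN; rewrite z1 lb.
Qed.

Lemma meg_cover : meg_set kept_and_tips.
Proof.
move=> x y xy; case/adj_cases: (xy) => [[yx _]|[yx _]|[xh yh Nxy _ _]].
- exact: meg_cover_up.
- rewrite [adj x y]adjv_sym in xy; have [s [t [? ? ? m]]] := meg_cover_up xy yx.
  by exists s, t; split=> //; exact: monitoredC.
exists x, y; rewrite !inE xh yh eqxx; split=> //.
  by apply: contraNneq Nxy => ->.
exact: (monitored_adj Gc).
Qed.

Theorem meg_number : meg_number_is layered (N + q + k.*2 + o.+1).
Proof.
split=> [|S]; last exact: meg_lower.
exists kept_and_tips; first exact: meg_cover.
by apply/eqP; rewrite eqn_leq meg_card meg_lower //; exact: meg_cover.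
Qed.

End Family.

(** * Choice of the parameters *)

Theorem theorem12 (b c d : nat) (hb : 2 <= b) (hbc : b <= c) (hcd : c <= d)
    (hb3 : b <> 3) (hexc : ~ (b = 2 /\ c = 2 /\ 2 < d)) :
  exists G : sgraph,
    [/\ connected_graph G,
        geodetic_number_is G 2,
        edge_geodetic_number_is G b,
        strong_edge_geodetic_number_is G c
      & meg_number_is G d].
Proof.
have [c2|c_gt2] := leqP c 2.
  have [-> -> ->] : [/\ b = 2, c = 2 & d = 2] by split; lia.
  by exists K2; exact: K2_numbers.
pose q := b - 3; pose N := c - q.+1; pose o := odd (d - c); pose k := (d - c)./2.
have N1 : 1 < N by rewrite /N /q; lia.
have bE : (if q == 0 then 2 else q.+3) = b by case: eqP; rewrite /q; lia.
have cE : (N + q).+1 = c by rewrite /N /q; lia.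
have dE : N + q + k.*2 + o.+1 = d by rewrite /k /o; lia.
exists (layered o k N q); split.
- exact: layered_connected.
- exact: g_number.
- by rewrite -bE; exact: eg_number.
- by rewrite -cE; exact: seg_number.
by rewrite -dE; exact: meg_number.
Qed.
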